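(* Let $F\subseteq\mathbb{R}^d$ be a non-empty compact set, and let $\Phi=\{\varphi_i\}_{i\in\Lambda}$ be a similarity IFS which satisfies the strong separation condition (SSC), such that $F=\Gamma_\Phi(T)$ for some tree without leaves $T\in\mathcal{T}'_\Lambda$. Then (1) $\{\dim_{\mathrm H}(A): A\in\mathcal{W}_F\}\supseteq\{\dim_{\mathrm H}(S): S\in\overline{\mathcal{S}_\Phi^T}\}$; (2) $\{\dim_{\mathrm H}(A): A\in\mathcal{W}_F\}\cap(d-1,d]=\{\dim_{\mathrm H}(B): B\text{ is a miniset of some }S\in\overline{\mathcal{S}_\Phi^T}\}\cap(d-1,d]$.
   Context: $\dim_{\mathrm H}$ is Hausdorff dimension, $Q=[0,1]^d$, $Q^\circ$ its interior. A similarity map is a map $\varphi:\mathbb{R}^d\to\mathbb{R}^d$ with $\|\varphi(x)-\varphi(y)\|=r\|x-y\|$ for all $x,y$, for some $r>0$; it is contracting if $r<1$ and expanding if $r\ge1$. For a compact $F\subseteq\mathbb{R}^d$, a miniset of $F$ is a non-empty set of the form $Q\cap\varphi(F)$ with $\varphi$ an expanding similarity; a microset of $F$ is any limit of a sequence of minisets of $F$ in the Hausdorff metric. $\mathcal{W}_F$ is the collection of microsets of $F$ that intersect $Q^\circ$. A similarity IFS is a finite non-empty collection $\Phi=\{\varphi_i\}_{i\in\Lambda}$ of contracting similarity maps of $\mathbb{R}^d$; its attractor $K$ is the unique non-empty compact set with $K=\bigcup_{i\in\Lambda}\varphi_i(K)$. $\Phi$ satisfies the SSC if $\varphi_i(K)\cap\varphi_j(K)=\emptyset$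 for all $i\ne j\in\Lambda$. The coding map is $\gamma_\Phi(i)=\lim_{n}\varphi_{i_1}\circ\dots\circ\varphi_{i_n}(0)$ for $i\in\Lambda^{\mathbb{N}}$. A tree with alphabet $\Lambda$ is a set $T\subseteq\Lambda^*=\bigcup_{n\ge0}\Lambda^n$ containing the empty word and closed under taking prefixes; $\partial T=\{i\in\Lambda^{\mathbb{N}}: i_1\dots i_n\in T\ \forall n\}$. $\mathcal{T}'_\Lambda$ is the set of trees with alphabet $\Lambda$ without leaves (every $v\in T$ has some $j\in\Lambda$ with $vj\in T$). For a tree $T$ with non-empty boundary, $\Gamma_\Phi(T)=\gamma_\Phi(\partial T)$. For $v\in T$, $T^v=\{w\in\Lambda^*: vw\in T\}$; $\mathcal{S}_\Phi^T=\{\Gamma_\Phi(T^v): v\in T\}$, and $\overline{\mathcal{S}_\Phi^T}$ is its closure in the Hausdorff metric. *)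

(* Defs.v *)
From HB Require Import structures.
From mathcomp Require Import all_boot all_order all_algebra.
From mathcomp Require Import all_classical all_reals all_analysis.

Set Implicit Arguments.
Unset Strict Implicit.
Unset Printing Implicit Defensive.

Import Order.TTheory GRing.Theory Num.Theory.
Import numFieldNormedType.Exports.

Local Open Scope classical_set_scope.
Local Open Scope ring_scope.

Section Metric.
Context {R : realType} {d : nat}.
Implicit Types (x y : 'rV[R]_d) (A B U : set 'rV[R]_d).

(* The library norm on 'rV[R]_d is the sup norm; similarities, diameters and
   the Hausdorff metric are taken for the Euclidean norm. Both norms induce the
   product topology used below for compactness, interiors and limits. *)
Definition enorm x : R := Num.sqrt (\sum_(i < d) x 0 i ^+ 2).

Definition enlargement (e : R) A : set 'rV[R]_d :=
  [set x | exists2 y, A y & enorm (x - y) <= e].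

(* +oo when no enlargement works; finite on non-empty compact sets. *)
Definition hausdorff_dist A B : \bar R :=
  ereal_inf [set e%:E | e in
    [set e : R | [/\ 0 <= e, A `<=` enlargement e B & B `<=` enlargement e A]]].

Definition nonempty_compact A := A !=set0 /\ compact A.

Definition hausdorff_closure (C : set (set 'rV[R]_d)) : set (set 'rV[R]_d) :=
  [set S | nonempty_compact S /\
    forall e : R, 0 < e -> exists2 A, C A & (hausdorff_dist A S < e%:E)%E].

(* diam set0 = -oo; cover_weight treats the empty set separately. *)
Definition diam U : \bar R :=
  ereal_sup [set (enorm (p.1 - p.2))%:E | p in U `*` U].

(* diam U ^ s with 0 ^ 0 = 1, except that the empty set contributes 0 even for
   s = 0, so that the 0-dimensional measure counts points. *)
Definition cover_weight (s : R) U : \bar R :=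
  if `[< U = set0 >] then 0%:E else poweR (diam U) s.

Definition hausdorff_premeasure (s delta : R) A : \bar R :=
  ereal_inf [set (\sum_(0 <= k <oo) cover_weight s (U k))%E | U in
    [set U : nat -> set 'rV[R]_d |
      A `<=` \bigcup_k U k /\ forall k, (diam (U k) <= delta%:E)%E]].

Definition hausdorff_measure (s : R) A : \bar R :=
  ereal_sup [set hausdorff_premeasure s delta A | delta in
    [set delta : R | 0 < delta]].

Definition hausdorff_dim A : \bar R :=
  ereal_inf [set s%:E | s in
    [set s : R | 0 <= s /\ hausdorff_measure s A = 0%E]].

Definition similarity (r : R) (f : 'rV[R]_d -> 'rV[R]_d) :=
  0 < r /\ forall x y, enorm (f x - f y) = r * enorm (x - y).

Definition contracting_similarity f := exists2 r : R, r < 1 & similarity r f.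
Definition expanding_similarity f := exists2 r : R, 1 <= r & similarity r f.

Definition cube : set 'rV[R]_d := [set x | forall i, 0 <= x 0 i <= 1].

Definition miniset (F B : set 'rV[R]_d) :=
  B !=set0 /\
  exists2 f, expanding_similarity f & B = cube `&` f @` F.

Definition microset (F A : set 'rV[R]_d) :=
  nonempty_compact A /\
  exists B : nat -> set 'rV[R]_d,
    (forall n, miniset F (B n)) /\
    hausdorff_dist (B n) A @[n --> \oo] --> 0%E.

Definition interior_microsets (F : set 'rV[R]_d) : set (set 'rV[R]_d) :=
  [set A | microset F A /\ A `&` interior cube !=set0].

End Metric.

Section Trees.
Context {L : finType}.

Definition is_tree (T : set (seq L)) :=
  T [::] /\ forall v w, prefix v w -> T w -> T v.

Definition leafless_tree (T : set (seq L)) :=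
  is_tree T /\ forall v, T v -> exists j, T (rcons v j).

(* Infinite words are indexed from 0. *)
Definition tree_boundary (T : set (seq L)) : set (nat -> L) :=
  [set i | forall n, T (mkseq i n)].

Definition subtree (T : set (seq L)) (v : seq L) : set (seq L) :=
  [set w | T (v ++ w)].

End Trees.

Section IFS.
Context {R : realType} {d : nat} {L : finType}.
Variable Phi : L -> 'rV[R]_d -> 'rV[R]_d.

Definition similarity_IFS :=
  (0 < #|L|)%N /\ forall i, contracting_similarity (Phi i).

Definition is_attractor (K : set 'rV[R]_d) :=
  nonempty_compact K /\ K = \bigcup_i (Phi i @` K).

(* Description operator: the set satisfying is_attractor, which exists and is
   unique for a similarity IFS (Hutchinson). *)
Definition attractor : set 'rV[R]_d := xget set0 is_attractor.

Definition SSC := forall i j, i != j ->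
  Phi i @` attractor `&` Phi j @` attractor = set0.

(* Phi i_1 \o ... \o Phi i_n for the word i_1 ... i_n *)
Definition word_map (w : seq L) (x : 'rV[R]_d) : 'rV[R]_d := foldr Phi x w.

Definition coding_map (i : nat -> L) : 'rV[R]_d :=
  lim (word_map (mkseq i n) 0 @[n --> \oo]).

Definition tree_set (T : set (seq L)) : set 'rV[R]_d :=
  coding_map @` tree_boundary T.

Definition tree_pieces (T : set (seq L)) : set (set 'rV[R]_d) :=
  [set tree_set (subtree T v) | v in T].

End IFS.

(* Main.v *)
(** Write F = Gamma(T) and S_v = Gamma(T^v). By the SSC, around the piece
    phi_v(S_v) the set F has nothing else within distance c r_v, where r_v is the
    ratio of phi_v. Hence magnifying by h o phi_v^-1, with h expanding enough, the
    cube sees only h(S_v), and limits of such minisets agree with h(S) inside the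
    open cube; placing the window where S has locally full dimension gives (1) and,
    since the boundary of the cube has dimension d - 1, one half of (2).
    Conversely, near a point of locally full dimension of a microset A, the n-th
    miniset is a single piece S_v, where v = v(n) is the prefix that undoes the
    magnification up to a factor in [1, 1 / min r_i]. The remaining similarities
    and the pieces converge to g and S, and A and Q & g(S) have the same dimension
    up to the boundary of the cube. *)
Require Import Defs.
From mathcomp Require Import all_boot all_order all_algebra.
From mathcomp Require Import all_classical all_reals all_analysis.
From mathcomp Require Import ring lra.
Import Order.TTheory GRing.Theory Num.Theory.
Import numFieldNormedType.Exports.
Local Open Scope classical_set_scope.
Local Open Scope ring_scope.

(** Hausdorff dimension is not continuous for the Hausdorff metric, so convergence of sets alone
    yields no equality of dimensions. Both directions therefore use inclusions and monotonicity: a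
    limit contains the trace of a similar copy of S on the open cube and is contained, globally or
    near one point, in its trace on the closed cube. Part (1) escapes the loss on the faces because
    S is not cut by a cube, so the window can be centred at the chosen point; a miniset may carry
    its dimension near a face. A point carrying the full dimension at a prescribed scale exists by
    compactness and finite stability of dimension. In each direction a single free ultrafilter on
    the naturals serves all limits: pieces, ratios and the values of the magnifications at every
    point converge at once, with no diagonal extraction. *)

(** * The Euclidean norm and the topology it shares with the sup norm *)

Section EuclideanNorm.
Context {R : realType} {d : nat}.
Implicit Types (x y z : 'rV[R]_d) (A : set 'rV[R]_d).

Definition dotp x y : R := \sum_(i < d) x 0 i * y 0 i.

Lemma enorm_sqr x : enorm x ^+ 2 = dotp x x.
Proof.
rewrite /enorm sqr_sqrtr; last by apply: sumr_ge0 => i _; exact: sqr_ge0.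
by apply: eq_bigr => i _; rewrite expr2.
Qed.

Lemma enorm_ge0 x : 0 <= enorm x. Proof. exact: sqrtr_ge0. Qed.

Lemma dotpC x y : dotp x y = dotp y x.
Proof. by apply: eq_bigr => i _; rewrite mulrC. Qed.

Lemma dotpDl x y z : dotp (x + y) z = dotp x z + dotp y z.
Proof. by rewrite -big_split; apply: eq_bigr => i _; rewrite mxE mulrDl. Qed.

Lemma dotpNl x y : dotp (- x) y = - dotp x y.
Proof. by rewrite -sumrN; apply: eq_bigr => i _; rewrite mxE mulNr. Qed.

Lemma dotpZl a x y : dotp (a *: x) y = a * dotp x y.
Proof. by rewrite mulr_sumr; apply: eq_bigr => i _; rewrite mxE mulrA. Qed.

Lemma dotpBB x y : dotp (x - y) (x - y) = dotp x x - 2 * dotp x y + dotp y y.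
Proof.
rewrite dotpDl dotpNl dotpC dotpDl dotpNl [dotp y (x - y)]dotpC dotpDl dotpNl.
by rewrite (dotpC y x); ring.
Qed.

Lemma enormZ a x : enorm (a *: x) = `|a| * enorm x.
Proof.
apply/eqP; rewrite -(eqrXn2 (n := 2)) ?enorm_ge0 ?mulr_ge0 ?enorm_ge0 //.
by rewrite exprMn !enorm_sqr dotpZl dotpC dotpZl real_normK ?num_real// mulrA.
Qed.

Lemma enormN x : enorm (- x) = enorm x.
Proof. by rewrite -scaleN1r enormZ normrN1 mul1r. Qed.

Lemma enorm0 : enorm (0 : 'rV[R]_d) = 0.
Proof. by rewrite -(scale0r 0) enormZ normr0 mul0r. Qed.

Lemma enormBC x y : enorm (x - y) = enorm (y - x).
Proof. by rewrite -enormN opprB. Qed.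

Lemma enorm_coord x i : `|x 0 i| <= enorm x.
Proof.
rewrite -(@ler_pXn2r _ 2) ?nnegrE ?enorm_ge0 // enorm_sqr real_normK ?num_real//.
rewrite /dotp (bigD1 i) //= expr2 lerDl.
by apply: sumr_ge0 => j _; rewrite -expr2 sqr_ge0.
Qed.

Lemma enorm_eq0 x : enorm x = 0 -> x = 0.
Proof.
move=> x0; apply/rowP => i; rewrite mxE; apply/normr0_eq0/le_anti.
by rewrite normr_ge0 andbT -x0 enorm_coord.
Qed.

Lemma cauchy_schwarz x y : dotp x y <= enorm x * enorm y.
Proof.
have [y0|y0] := eqVneq (enorm y) 0.
  rewrite y0 mulr0 (enorm_eq0 _ y0) /dotp big1 // => i _.
  by rewrite mxE mulr0.
have yp : 0 < enorm y by rewrite lt_neqAle eq_sym y0 enorm_ge0.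
have /le_trans -> // : dotp x y <= `|dotp x y| by exact: ler_norm.
rewrite -(@ler_pXn2r _ 2) ?nnegrE ?mulr_ge0 ?enorm_ge0 // real_normK ?num_real//.
(* With a, b the norms of x, y and c their product, this square is b^2 (b^2 a^2 - c^2). *)
have := sqr_ge0 (enorm (enorm y ^+ 2 *: x - dotp x y *: y)).
rewrite (enorm_sqr (_ - _)) dotpBB !dotpZl (dotpC x) (dotpC y (_ *: y)).
rewrite (dotpC x (_ *: y)).
rewrite !dotpZl -!enorm_sqr (dotpC y x).
set a := enorm x; set b := enorm y; set c := dotp x y => h.
have : 0 <= b ^+ 2 * (b ^+ 2 * a ^+ 2 - c ^+ 2) by apply: le_trans h _; nra.
by rewrite pmulr_rge0 ?exprn_gt0// subr_ge0 exprMn mulrC.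
Qed.

Lemma ler_enormD x y : enorm (x + y) <= enorm x + enorm y.
Proof.
rewrite -(@ler_pXn2r _ 2) ?nnegrE ?addr_ge0 ?enorm_ge0 //.
rewrite -{1}[y]opprK (enorm_sqr (_ - _)) dotpBB -!enorm_sqr enormN dotpC dotpNl dotpC.
by have := cauchy_schwarz x y; nra.
Qed.

Lemma ler_enormB z x y : enorm (x - y) <= enorm (x - z) + enorm (z - y).
Proof. by rewrite -{1}(subrK z x) -addrA ler_enormD. Qed.

(** The crude factor d, instead of its square root, is the bound later used for the diameter of the
    cube, hence in every magnification threshold. *)
Lemma enorm_le_coord x (e : R) : (forall i, `|x 0 i| <= e) -> enorm x <= d%:R * e.
Proof.
move=> xe; have [d0|d_gt0] := posnP d.
  rewrite /enorm big1 ?sqrtr0 ?d0 ?mul0r // => i _.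
  by have := leq_trans (ltn_ord i) (eq_leq d0).
pose i0 := Ordinal d_gt0.
have e0 : 0 <= e by exact: le_trans (xe i0).
rewrite -(@ler_pXn2r _ 2) ?nnegrE ?mulr_ge0 ?enorm_ge0 // enorm_sqr.
apply: (@le_trans _ _ (\sum_(i < d) e ^+ 2)).
  apply: ler_sum => i _; rewrite -expr2 -real_normK ?num_real//.
  by rewrite lerXn2r ?nnegrE.
rewrite sumr_const card_ord -[leLHS]mulr_natl exprMn ler_wpM2r ?sqr_ge0//.
by rewrite -natrX ler_nat -{1}(expn1 d) leq_pexp2l.
Qed.

Lemma norm_le_enorm x : `|x| <= enorm x.
Proof.
rewrite [leLHS]mx_normrE; apply: bigmax_le => [|[i j] _]; first exact: enorm_ge0.
by rewrite /= ord1 enorm_coord.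
Qed.

Lemma enorm_le_norm x : enorm x <= d%:R * `|x|.
Proof.
apply: enorm_le_coord => i; rewrite [leRHS]mx_normrE.
exact: (le_bigmax _ (fun ij => `|x ij.1 ij.2|) (0, i)).
Qed.

Lemma nbhs_enormP x A :
  nbhs x A <-> exists2 e : R, 0 < e & forall y, enorm (x - y) < e -> A y.
Proof.
split=> [/nbhs_normP[e /= e0 xA]|[e e0 xA]].
  by exists e => // y xy; apply: xA; apply: le_lt_trans (norm_le_enorm _) xy.
(* [d.+1] rather than [d] keeps the divisor positive in dimension 0. *)
apply: (iffRL (@nbhs_normP R 'rV[R]_d x A)); exists (e / d.+1%:R) => /=.
  by rewrite divr_gt0.
move=> y; rewrite /ball_ /= ltr_pdivlMr // => xy; apply: xA.
apply: le_lt_trans (enorm_le_norm _) (le_lt_trans _ xy).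
by rewrite mulrC ler_wpM2l // ler_nat.
Qed.

Lemma closureP_enorm A x : closure A x <->
  forall e : R, 0 < e -> exists2 y, A y & enorm (x - y) < e.
Proof.
split=> [Ax e e0|xA B /nbhs_enormP[e e0 xB]].
  have [|y [Ay yB]] := Ax [set y | enorm (x - y) < e].
    by apply/nbhs_enormP; exists e.
  by exists y.
by have [y Ay xy] := xA e e0; exists y; split=> //; exact: xB.
Qed.

Lemma closedP_enorm A : closed A <->
  forall x, (forall e : R, 0 < e -> exists2 y, A y & enorm (x - y) < e) -> A x.
Proof.
by split=> cA x => [|/closureP_enorm]; [move/closureP_enorm|]; exact: cA.
Qed.

Lemma compactP_enorm A : compact A <->
  (exists M : R, forall x, A x -> enorm x <= M) /\ closed A.
Proof.
split=> [cA|[[M AM] cA]].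
  split; last by apply: compact_closed => //; exact: norm_hausdorff.
  have [M [_ MA]] := compact_bounded cA.
  exists (d%:R * (M + 1)) => x Ax; apply: le_trans (enorm_le_norm _) _.
  by apply: ler_wpM2l => //; apply: MA => //; rewrite ltrDl.
apply: bounded_closed_compact => //; exists M; split; first exact: num_real.
move=> N MN x Ax; apply: le_trans (norm_le_enorm _) _.
exact: le_trans (AM _ Ax) (ltW MN).
Qed.

Lemma interiorP_enorm A x :
  interior A x <-> exists2 e : R, 0 < e & forall y, enorm (x - y) < e -> A y.
Proof. exact: nbhs_enormP. Qed.

End EuclideanNorm.

(** * Similarities of Euclidean space are bijective *)

Section Similarity.
Context {R : realType} {d : nat}.
Implicit Types (x y : 'rV[R]_d) (f g : 'rV[R]_d -> 'rV[R]_d).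

Lemma similarity_gt0 {r : R} {f} : similarity r f -> 0 < r.
Proof. by case. Qed.

Lemma similarityE {r : R} {f} x y :
  similarity r f -> enorm (f x - f y) = r * enorm (x - y).
Proof. by case. Qed.

Lemma similarity_comp (r s : R) f g :
  similarity r f -> similarity s g -> similarity (r * s) (f \o g).
Proof.
move=> [r0 fr] [s0 gs]; split; first exact: mulr_gt0.
by move=> x y /=; rewrite fr gs mulrA.
Qed.

Lemma similarity_id : similarity 1 (@id 'rV[R]_d).
Proof. by split=> // x y; rewrite mul1r. Qed.

(* After translating, f preserves inner products up to r^2; the images of the
   basis vectors give a matrix M with M M^T = r^2, hence M^T M = r^2, which
   recovers f x from its inner products with the rows of M. *)
Lemma similarity_surj (r : R) f y : similarity r f -> exists x, f x = y.
Proof.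
move=> [r0 fr]; pose g x := f x - f 0.
have gg x : enorm (g x) = r * enorm x by rewrite /g fr subr0.
have gB x z : enorm (g x - g z) = r * enorm (x - z).
  by rewrite -fr /g opprB addrA subrK.
have gdot x z : dotp (g x) (g z) = r ^+ 2 * dotp x z.
  have := dotpBB (g x) (g z); have := dotpBB x z.
  by rewrite -!enorm_sqr gB !gg; nra.
pose M : 'M[R]_d := \matrix_i g (delta_mx 0 i).
have rowE (i : 'I_d) z : dotp z (delta_mx 0 i) = z 0 i.
  rewrite /dotp (bigD1 i) //= mxE !eqxx mulr1 big1 ?addr0 // => j ji.
  by rewrite mxE eqxx (negPf ji) mulr0.
have gM x : g x *m M^T = r ^+ 2 *: x.
  apply/rowP => i; rewrite !mxE -rowE -gdot; apply: eq_bigr => j _.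
  by rewrite !mxE.
have r2 : r ^+ 2 != 0 by rewrite expf_neq0 // gt_eqF.
have MM : M *m ((r ^+ 2)^-1 *: M^T) = 1%:M.
  apply/row_matrixP => i; rewrite row_mul -scalemxAr rowK gM scalerA mulVf //.
  by rewrite scale1r row1.
have gE x : g x = x *m M.
  rewrite -{1}[g x]mulmx1 -(mulmx1C MM) mulmxA -scalemxAr gM scalerA mulVf //.
  by rewrite scale1r.
exists ((y - f 0) *m ((r ^+ 2)^-1 *: M^T)).
have := gE ((y - f 0) *m ((r ^+ 2)^-1 *: M^T)).
rewrite -mulmxA (mulmx1C MM) mulmx1 => /eqP.
by rewrite subr_eq subrK => /eqP.
Qed.

Lemma similarity_inv (r : R) f : similarity r f ->
  exists2 g, similarity r^-1 g & cancel g f /\ cancel f g.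
Proof.
move=> fs; have [r0 fr] := fs.
have /choice[g fg] : forall y, exists x, f x = y.
  by move=> y; exact: similarity_surj fs.
exists g; last first.
  split=> // x; apply/eqP; rewrite -subr_eq0; apply/eqP/enorm_eq0.
  by apply: (mulfI (lt0r_neq0 r0)); rewrite -fr fg subrr enorm0 mulr0.
split; first by rewrite invr_gt0.
by move=> x y; rewrite -{2}(fg x) -{2}(fg y) fr mulKf // gt_eqF.
Qed.

End Similarity.

(** * Hausdorff distance through enlargements *)

Section HausdorffDistance.
Context {R : realType} {d : nat}.
Implicit Types (x y : 'rV[R]_d) (A B : set 'rV[R]_d).

Lemma hausdorff_dist_le (e : R) A B : 0 <= e ->
  A `<=` enlargement e B -> B `<=` enlargement e A ->
  (hausdorff_dist A B <= e%:E)%E.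
Proof. by move=> e0 AB BA; apply: ereal_inf_lbound; exists e. Qed.

Lemma hausdorff_dist_lt (e : R) A B : (hausdorff_dist A B < e%:E)%E ->
  A `<=` enlargement e B /\ B `<=` enlargement e A.
Proof.
move=> /ereal_inf_lt[_ [e' [e'0 AB BA] <-]]; rewrite lte_fin => /ltW e'e.
by split=> x => [/AB|/BA] [y ? xy]; exists y => //; exact: le_trans xy e'e.
Qed.

Lemma hausdorff_dist_ge0 A B : (0 <= hausdorff_dist A B)%E.
Proof. by apply: le_ereal_inf_tmp => _ [e [e0 _ _] <-]; rewrite lee_fin. Qed.

End HausdorffDistance.

(* Limits along an ultrafilter stand in for extraction of subsequences: every
   bounded sequence of points converges, and every sequence of uniformly bounded
   sets converges in the Hausdorff metric (Blaschke). *)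
Section UltraLimits.
Context {R : realType} {d : nat} (U : set_system nat) {UU : UltraFilter U}.
Implicit Types (x : 'rV[R]_d) (u : nat -> 'rV[R]_d) (B : nat -> set 'rV[R]_d).

(** Maximality of the ultrafilter: if a property does not hold along [U], its failure does, so
    counterexamples can be chosen along the same [U]. *)
Lemma ultra_near_or (P : set nat) :
  (\forall n \near U, P n) \/ (\forall n \near U, ~ P n).
Proof. exact: in_ultra_setVsetC. Qed.

Lemma ultra_choice {T : pointedType} (P : nat -> T -> Prop) :
  (\forall n \near U, exists y, P n y) ->
  exists u : nat -> T, \forall n \near U, P n (u n).
Proof.
move=> UP; have /choice[u uP] : forall n, exists y, (exists z, P n z) -> P n y.
  move=> n; have [[z Pz]|nP] := pselect (exists z, P n z); first by exists z.
  by exists point.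
by exists u; apply: filterS UP => n; exact: uP.
Qed.

Lemma ultra_compact_cvg {T : topologicalType} (K : set T) (u : nat -> T) :
  compact K -> (\forall n \near U, K (u n)) ->
  exists2 l, K l & forall C, nbhs l C -> \forall n \near U, C (u n).
Proof.
move=> cK UK; have [l [Kl lu]] := cK (u @ U) _ UK; exists l => // C lC.
have [//|nC] := ultra_near_or (fun n => C (u n)).
by have [y [/= nCy Cy]] := lu (~` C) C nC lC.
Qed.

Definition ucvg u x := forall e : R, 0 < e -> \forall n \near U, enorm (x - u n) < e.

Lemma ultra_bounded_cvg u (M : R) :
  (\forall n \near U, enorm (u n) <= M) -> exists x, ucvg u x.
Proof.
move=> uM; have cK : compact [set x : 'rV[R]_d | enorm x <= M].
  apply/compactP_enorm; split; first by exists M.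
  apply/closedP_enorm => x xM; rewrite /=; apply/ler_addgt0Pr => e e0.
  have [y /= yM xy] := xM e e0.
  by have := ler_enormD (x - y) y; rewrite subrK; lra.
have [x _ ux] := ultra_compact_cvg _ _ cK uM.
exists x => e e0; apply: (ux [set y | enorm (x - y) < e]).
by apply/nbhs_enormP; exists e.
Qed.

Lemma ultra_segment_cvg (a b : R) (r : nat -> R) : (forall n, a <= r n <= b) ->
  exists2 l, a <= l <= b &
    forall e : R, 0 < e -> \forall n \near U, `|l - r n| < e.
Proof.
move=> rab; have [|l lab rl] := ultra_compact_cvg _ r (@segment_compact R a b).
  by apply: nearW => n; rewrite /= in_itv; exact: rab.
exists l => [|e e0]; first by move: lab; rewrite /= in_itv.
exact: (rl [set y | `|l - y| < e]) (nbhsx_ballx _ _ e0).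
Qed.

(** Along an ultrafilter the lower and upper Kuratowski limits coincide, so this one set has the
    closure properties of both. *)
Definition ulim B : set 'rV[R]_d := [set x | forall e : R, 0 < e ->
  \forall n \near U, exists2 y, B n y & enorm (x - y) < e].

Lemma ulim_closed B : closed (ulim B).
Proof.
apply/closedP_enorm => x xB e e0.
have [y yB xy] := xB (e / 2) (divr_gt0 e0 (ltr0n _ 2)).
apply: filterS (yB (e / 2) (divr_gt0 e0 (ltr0n _ 2))) => n [z Bz yz].
by exists z => //; have := ler_enormB y x z; lra.
Qed.

Lemma ulim_bounded B (M : R) x :
  (forall n y, B n y -> enorm y <= M) -> ulim B x -> enorm x <= M.
Proof.
move=> BM Bx; apply/ler_addgt0Pr => e e0.
have [n [y /BM yM xy]] := filter_ex (Bx e e0).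
by have := ler_enormD (x - y) y; rewrite subrK; lra.
Qed.

Lemma ulim_compact B (M : R) :
  (forall n y, B n y -> enorm y <= M) -> compact (ulim B).
Proof.
move=> BM; apply/compactP_enorm; split; last exact: ulim_closed.
by exists M => x; exact: ulim_bounded.
Qed.

Lemma ulim_sub B (A : set 'rV[R]_d) : closed A ->
  (\forall n \near U, B n `<=` A) -> ulim B `<=` A.
Proof.
move=> /closedP_enorm cA BA x Bx; apply: cA => e e0.
have [n [nBA [y By xy]]] := filter_ex (filterI BA (Bx e e0)).
by exists y => //; exact: nBA.
Qed.

Lemma ulim_ucvg B u x : (\forall n \near U, B n (u n)) -> ucvg u x -> ulim B x.
Proof.
by move=> Bu ux e e0; apply: filterS2 Bu (ux e e0) => n Bn xn; exists (u n).
Qed.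

Lemma ulim_nonempty B (M : R) : (forall n y, B n y -> enorm y <= M) ->
  (\forall n \near U, B n !=set0) -> ulim B !=set0.
Proof.
move=> BM /ultra_choice[u Bu]; have [|x ux] := ultra_bounded_cvg u M.
  by apply: filterS Bu => n /BM.
by exists x; exact: ulim_ucvg ux.
Qed.

(** If one of the two inclusions failed along [U], the bounded sequence of offending points would
    converge to a point of [ulim B], which is close both to these points and to the sets [B n]. *)
Lemma hausdorff_dist_ulim B (M e : R) : (forall n y, B n y -> enorm y <= M) ->
  0 < e -> \forall n \near U, (hausdorff_dist (B n) (ulim B) <= e%:E)%E.
Proof.
move=> BM e0; have e20 : 0 < e / 2 by exact: divr_gt0.
have BL : \forall n \near U, B n `<=` enlargement e (ulim B).
  have [//|] := ultra_near_or (fun n => B n `<=` enlargement e (ulim B)).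
  move=> nB; have [|u uP] := ultra_choice
      (fun n y => B n y /\ ~ enlargement e (ulim B) y).
    apply: filterS nB => n nB; apply: contrapT => nex; apply: nB => y By.
    by apply: contrapT => ny; apply: nex; exists y.
  have [|x ux] := ultra_bounded_cvg u M.
    by apply: filterS uP => n [/BM].
  have Lx : ulim B x by apply: ulim_ucvg ux; apply: filterS uP => n [].
  have [n [[_ nLu] xu]] := filter_ex (filterI uP (ux e e0)).
  by exfalso; apply: nLu; exists x => //; rewrite enormBC ltW.
have LB : \forall n \near U, ulim B `<=` enlargement e (B n).
  have [//|] := ultra_near_or (fun n => ulim B `<=` enlargement e (B n)).
  move=> nB; have [|u uP] := ultra_choice
      (fun n y => ulim B y /\ ~ enlargement e (B n) y).
    apply: filterS nB => n nB; apply: contrapT => nex; apply: nB => y By.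
    by apply: contrapT => ny; apply: nex; exists y.
  have [|x ux] := ultra_bounded_cvg u M.
    by apply: filterS uP => n [/(ulim_bounded _ _ _ BM)].
  have Lx : ulim B x.
    apply: (iffLR (closedP_enorm _) (ulim_closed B)) => e' e'0.
    by have [n [[? _] ?]] := filter_ex (filterI uP (ux e' e'0)); exists (u n).
  have [n [[[_ nBu] xu] [y By xy]]] :=
    filter_ex (filterI (filterI uP (ux _ e20)) (Lx _ e20)).
  exfalso; apply: nBu; exists y => //.
  by have := ler_enormB x (u n) y; rewrite (enormBC (u n) x); lra.
by apply: filterS2 BL LB => n ? ?; apply: hausdorff_dist_le => //; exact: ltW.
Qed.

End UltraLimits.

(** * Sets of vanishing Hausdorff measure *)

Section NullSets.
Context {R : realType} {d : nat}.
Implicit Types (s : R) (A B : set 'rV[R]_d).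

(* Vanishing of the s-dimensional Hausdorff measure, in terms of real upper
   bounds a k on the diameters and w k on the weights of the covering sets. *)
Definition hnull s A := forall delta e : R, 0 < delta -> 0 < e ->
  exists (V : nat -> set 'rV[R]_d) (a w : nat -> R),
  [/\ A `<=` \bigcup_k V k,
      forall k, 0 <= a k <= delta,
      forall k x y, V k x -> V k y -> enorm (x - y) <= a k,
      forall k, 0 <= w k /\ (V k !=set0 -> a k `^ s <= w k) &
      forall n, \sum_(0 <= k < n) w k <= e].

Lemma diam_le (U : set 'rV[R]_d) (a : R) :
  (forall x y, U x -> U y -> enorm (x - y) <= a) -> (diam U <= a%:E)%E.
Proof.
move=> Ua; apply: ge_ereal_sup => _ [[x y] [/= Ux Uy] <-].
by rewrite lee_fin; exact: Ua.
Qed.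

Lemma diam_ge0 (U : set 'rV[R]_d) : U !=set0 -> (0 <= diam U)%E.
Proof.
move=> [x Ux]; apply: ereal_sup_ubound; exists (x, x) => //=.
by rewrite subrr enorm0.
Qed.

Lemma cover_weight_ge0 s (U : set 'rV[R]_d) : (0 <= cover_weight s U)%E.
Proof. by rewrite /cover_weight; case: ifP => // _; exact: poweR_ge0. Qed.

Lemma hausdorff_premeasure_ge0 s delta A : (0 <= hausdorff_premeasure s delta A)%E.
Proof.
apply: le_ereal_inf_tmp => _ [V _ <-].
by apply: nneseries_ge0 => n _ _; exact: cover_weight_ge0.
Qed.

Lemma hnullP s A : 0 <= s -> hausdorff_measure s A = 0%E <-> hnull s A.
Proof.
move=> s0; split=> [A0 delta e delta0 e0|nA].
  have : (hausdorff_premeasure s delta A < e%:E)%E.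
    apply: (@le_lt_trans _ _ 0%E); last by rewrite lte_fin.
    by rewrite -A0; apply: ereal_sup_ubound; exists delta.
  move=> /ereal_inf_lt[_ [V [AV Vd] <-] sume].
  have diamE k : V k !=set0 -> diam (V k) = (fine (diam (V k)))%:E.
    move=> Vk; rewrite fineK// fin_real// (lt_le_trans _ (diam_ge0 _ Vk)) //=.
    by apply: le_lt_trans (Vd k) _; exact: ltry.
  (* The empty set has diameter -oo and weight 0, while 0 to the power 0 is 1; so empty sets are
     given bound and weight 0 separately. *)
  pose a k := if `[< V k = set0 >] then 0 else fine (diam (V k)).
  pose w k := if `[< V k = set0 >] then 0 else a k `^ s.
  have V0 k : ~ (V k = set0) -> V k !=set0.
    by move=> ?; apply/set0P/eqP.
  exists V, a, w; split=> //.
  - move=> k; rewrite /a; case: asboolP => [_|/V0 Vk]; first by rewrite lexx ltW.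
    by rewrite -!lee_fin -diamE // diam_ge0 //=; exact: Vd.
  - move=> k x y Vx Vy; rewrite /a; case: asboolP => [V0k|/V0 Vk].
      by move: Vx; rewrite V0k.
    rewrite -lee_fin -diamE //; apply: ereal_sup_ubound.
    by exists (x, y).
  - move=> k; rewrite /w; case: asboolP => [->|_]; first by split=> // -[].
    by rewrite powR_ge0.
  - move=> n; rewrite -lee_fin; apply: le_trans (ltW sume).
    rewrite -sumEFin; rewrite (eq_bigr (fun k => cover_weight s (V k))); last first.
      move=> k _; rewrite /w /cover_weight /a; case: asboolP => // /V0 Vk.
      by rewrite (diamE _ Vk) poweR_EFin.
    by apply: nneseries_lim_ge => k _ _; exact: cover_weight_ge0.
apply/eqP; rewrite eq_le; apply/andP; split; last first.
  apply: (@le_trans _ _ (hausdorff_premeasure s 1 A)).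
    exact: hausdorff_premeasure_ge0.
  by apply: ereal_sup_ubound; exists 1 => //=.
apply: ge_ereal_sup => _ [delta delta0 <-]; apply/lee_addgt0Pr => e e0.
rewrite add0e; have [V [a [w [AV ad Va aw we]]]] := nA _ _ delta0 e0.
apply: (@le_trans _ _ (\sum_(0 <= k <oo) cover_weight s (V k))%E).
  apply: ereal_inf_lbound; exists V => //; split=> // k.
  apply: le_trans (diam_le _ _ (Va k)) _; rewrite lee_fin.
  by case/andP: (ad k).
apply: (@le_trans _ _ (\sum_(0 <= k <oo) (w k)%:E)%E).
  apply: lee_nneseries => [k _ _|k _]; first exact: cover_weight_ge0.
  rewrite /cover_weight; case: asboolP => [_|/eqP/set0P Vk].
    by rewrite lee_fin; case: (aw k).
  case/andP: (ad k) => a0 _; apply: (@le_trans _ _ ((a k)%:E `^ s)%E).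
    apply: gt0_ler_poweR => //; rewrite ?in_itv /= ?leey ?andbT ?lee_fin //.
      exact: diam_ge0.
    exact: diam_le (Va k).
  by rewrite poweR_EFin lee_fin; case: (aw k) => _; apply.
apply: lime_le.
  by apply: is_cvg_nneseries => k _ _; rewrite lee_fin; case: (aw k).
by apply: nearW => n; rewrite sumEFin lee_fin.
Qed.

Lemma hnull_sub s A B : A `<=` B -> hnull s B -> hnull s A.
Proof.
move=> AB nB delta e delta0 e0.
have [V [a [w [BV ad Va aw we]]]] := nB _ _ delta0 e0.
by exists V, a, w; split=> //; exact: subset_trans BV.
Qed.

Lemma hnull_le s t A : 0 <= s -> s <= t -> hnull s A -> hnull t A.
Proof.
move=> s0 st nA delta e delta0 e0.
(* For diameters in (0,1] a larger exponent gives a smaller weight. *)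
have delta'0 : 0 < Num.min delta 1 by rewrite lt_min delta0 ltr01.
have [V [a [w [BV ad Va aw we]]]] := nA _ _ delta'0 e0.
exists V, a, w; split=> //.
  by move=> k; have := ad k; rewrite le_min => /and3P[-> ->].
move=> k; have [w0 awk] := aw k; split=> // /awk; apply: le_trans.
have := ad k; rewrite le_min => /and3P[a0 _ a1].
(* Diameter 0 is special: its power is 1 at exponent 0, but [t = 0] forces [s = t]. *)
have [->|an0] := eqVneq (a k) 0; last first.
  by apply: ger_powR => //; rewrite lt_neqAle eq_sym an0 a0.
have [t0|tn0] := eqVneq t 0; last by rewrite powR0 ?powR_ge0.
by have -> : s = t by apply/le_anti; rewrite st t0 s0.
Qed.

Lemma hnullU s A B : hnull s A -> hnull s B -> hnull s (A `|` B).
Proof.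
move=> nA nB delta e delta0 e0; have e20 : 0 < e / 2 by exact: divr_gt0.
have [V [a [w [AV ad Va aw we]]]] := nA _ _ delta0 e20.
have [V' [a' [w' [AV' ad' Va' aw' we']]]] := nB _ _ delta0 e20.
(* The two covers are interleaved: even indices cover [A], odd ones [B]. *)
pose mix (T : Type) (u v : nat -> T) k := if odd k then v k./2 else u k./2.
exists (mix _ V V'), (mix _ a a'), (mix _ w w'); split.
- move=> x [/AV|/AV'] [k _ Vk].
    by exists k.*2; rewrite // /mix odd_double doubleK.
  by exists k.*2.+1; rewrite // /mix /= odd_double /= uphalf_double.
- by move=> k; rewrite /mix; case: ifP.
- by move=> k x y; rewrite /mix; case: ifP => _; [exact: Va'|exact: Va].
- by move=> k; rewrite /mix; case: ifP.
have mixE n : \sum_(0 <= k < n.*2) mix R w w' k =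
    \sum_(0 <= k < n) w k + \sum_(0 <= k < n) w' k.
  elim: n => [|n ihn]; first by rewrite !big_nil addr0.
  rewrite doubleS !big_nat_recr //= ihn /mix /= odd_double /= uphalf_double.
  by rewrite doubleK; ring.
move=> n; apply: (@le_trans _ _ (\sum_(0 <= k < n.*2) mix R w w' k)).
  rewrite -addnn (big_cat_nat _ (leq_addr n n)) //= lerDl.
  apply: sumr_ge0 => k _; rewrite /mix; case: ifP => _.
    by case: (aw' k./2).
  by case: (aw k./2).
by rewrite mixE; have := we n; have := we' n; lra.
Qed.

Lemma hnull_bigcup {I : eqType} (l : seq I) (V : I -> set 'rV[R]_d) s :
  (forall i, hnull s (V i)) -> hnull s (\bigcup_(i in [set` l]) V i).
Proof.
move=> nV; elim: l => [|i l ihl].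
  move=> delta e delta0 e0; exists (fun=> set0), (fun=> 0), (fun=> 0).
  split=> //; first by move=> x [i].
  - by move=> _; rewrite lexx ltW.
  - by move=> k; split=> // -[].
  - by move=> n; rewrite big1 // ltW.
apply: hnull_sub (hnullU _ _ _ (nV i) ihl) => x [j /=].
by rewrite inE => /predU1P[->|jl] Vx; [left|right; exists j].
Qed.

Lemma hnull_finite s A : (forall delta e : R, 0 < delta -> 0 < e ->
    exists (I : finType) (V : I -> set 'rV[R]_d) (a : R),
    [/\ A `<=` \bigcup_i V i, 0 <= a <= delta,
        forall i x y, V i x -> V i y -> enorm (x - y) <= a &
        #|I|%:R * a `^ s <= e]) -> hnull s A.
Proof.
move=> fA delta e delta0 e0.
have {fA} [J [V [a [AV ad Va ae]]]] := fA _ _ delta0 e0.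
pose W k := if insub k is Some i then V (enum_val (i : 'I_#|J|)) else set0.
pose w k := if (k < #|J|)%N then a `^ s else 0.
exists W, (fun=> a), w; split=> //.
- move=> x /AV[i _ Vi]; exists (enum_rank i) => //.
  by rewrite /W valK enum_rankK.
- by move=> k x y; rewrite /W; case: insubP => // i _ _; exact: Va.
- move=> k; rewrite /w; case: ifP => [_|kJ]; first by rewrite powR_ge0.
  by split=> // -[x]; rewrite /W insubF.
move=> n; apply: le_trans ae; rewrite /w -big_mkcond /=.
rewrite big_const_seq iter_addr_0 -[leLHS]mulr_natl ler_wpM2r ?powR_ge0 //.
rewrite ler_nat -size_filter.
have /uniq_leq_size : uniq [seq k <- index_iota 0 n | (k < #|J|)%N].
  by rewrite filter_uniq ?iota_uniq.
move=> /(_ (iota 0 #|J|)); rewrite size_iota; apply => k.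
by rewrite mem_filter mem_iota add0n => /andP[].
Qed.

Lemma hnull_similarity s (r : R) f A : 0 <= s -> similarity r f ->
  hnull s A -> hnull s (f @` A).
Proof.
move=> s0 [r0 fr] nA delta e delta0 e0.
have rs0 : 0 < r `^ s by exact: powR_gt0.
have [V [a [w [AV ad Va aw we]]]] := nA _ _ (divr_gt0 delta0 r0) (divr_gt0 e0 rs0).
exists (fun k => f @` V k), (fun k => r * a k), (fun k => r `^ s * w k); split.
- by move=> _ [x /AV[k _ Vk] <-]; exists k => //; exists x.
- move=> k; have := ad k; rewrite ler_pdivlMr // mulrC => /andP[a0 ->].
  by rewrite mulr_ge0 // ltW.
- move=> k _ _ [x Vx <-] [y Vy <-]; rewrite fr ler_pM2l //; exact: Va Vx Vy.
- move=> k; have [w0 awk] := aw k; split; first by rewrite mulr_ge0 // ltW.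
  move=> [_ [x Vx _]]; rewrite powRM ?(ltW r0) //; last by case/andP: (ad k).
  by rewrite ler_pM2l // awk //; exists x.
- move=> n; rewrite -mulr_sumr mulrC -ler_pdivlMr //; exact: we.
Qed.

End NullSets.

(** * Monotonicity, finite stability and localisation of Hausdorff dimension *)

Section Dimension.
Context {R : realType} {d : nat}.
Implicit Types (s : R) (A B : set 'rV[R]_d).

Lemma hausdorff_dim_ge0 A : (0 <= hausdorff_dim A)%E.
Proof. by apply: le_ereal_inf_tmp => _ [s [s0 _] <-]; rewrite lee_fin. Qed.

Lemma hnull_dim_le s A : 0 <= s -> hnull s A -> (hausdorff_dim A <= s%:E)%E.
Proof.
by move=> s0 nA; apply: ereal_inf_lbound; exists s => //; split=> //; exact/hnullP.
Qed.

Lemma hnull_dim_lt s A : (hausdorff_dim A < s%:E)%E -> hnull s A.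
Proof.
move=> /ereal_inf_lt[_ [t [t0 /(hnullP _ _ t0) nA] <-]]; rewrite lte_fin => ts.
by apply: hnull_le nA => //; exact: ltW.
Qed.

(** With [hnull_dim_lt], this reduces comparisons of dimensions to comparisons of null sets at
    exponents strictly above [D]; the critical exponent itself is never examined. *)
Lemma hausdorff_dim_le (D : \bar R) A : (0 <= D)%E ->
  (forall s : R, (D < s%:E)%E -> hnull s A) -> (hausdorff_dim A <= D)%E.
Proof.
move=> D0 nA; rewrite leNgt; apply/negP.
case: D D0 nA => [D| |] // D0 nA; last by rewrite ltNge leey.
move=> DA; have lt s : D < s -> (hausdorff_dim A <= s%:E)%E.
  move=> Ds; apply: hnull_dim_le; last by apply: nA; rewrite lte_fin.
  by apply: le_trans (ltW Ds); rewrite -lee_fin.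
move: DA; apply/negP; rewrite -leNgt; apply/lee_addgt0Pr => e e0.
by apply: lt; rewrite ltrDl.
Qed.

Lemma hausdorff_dim_sub A B : A `<=` B -> (hausdorff_dim A <= hausdorff_dim B)%E.
Proof.
move=> AB; apply: hausdorff_dim_le; first exact: hausdorff_dim_ge0.
by move=> s /hnull_dim_lt; exact: hnull_sub.
Qed.

Lemma hausdorff_dimU A B :
  (hausdorff_dim (A `|` B) <= maxe (hausdorff_dim A) (hausdorff_dim B))%E.
Proof.
apply: hausdorff_dim_le; first by rewrite le_max hausdorff_dim_ge0.
move=> s; rewrite gt_max => /andP[As Bs].
by apply: hnullU; exact: hnull_dim_lt.
Qed.

Lemma hausdorff_dim_similarity_le (r : R) f A : similarity r f ->
  (hausdorff_dim (f @` A) <= hausdorff_dim A)%E.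
Proof.
move=> fr; apply: hausdorff_dim_le; first exact: hausdorff_dim_ge0.
move=> s As; apply: hnull_similarity fr _; last exact: hnull_dim_lt.
by rewrite -lee_fin; apply: le_trans (ltW As); exact: hausdorff_dim_ge0.
Qed.

Lemma hausdorff_dim_similarity (r : R) f A : similarity r f ->
  hausdorff_dim (f @` A) = hausdorff_dim A.
Proof.
move=> fr; have [g gr [gK fK]] := similarity_inv _ _ fr.
apply/eqP; rewrite eq_le (hausdorff_dim_similarity_le _ _ _ fr) /=.
apply: le_trans (hausdorff_dim_similarity_le _ _ (f @` A) gr).
apply: hausdorff_dim_sub => x Ax; exists (f x); last exact: fK.
by exists x.
Qed.

Lemma hausdorff_dim_finite_cover {I : eqType} (l : seq I) (V : I -> set 'rV[R]_d) A :
  l != [::] -> A `<=` \bigcup_(i in [set` l]) V i ->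
  exists2 i, i \in l & (hausdorff_dim A <= hausdorff_dim (A `&` V i))%E.
Proof.
suff H B : l != [::] -> B `<=` \bigcup_(i in [set` l]) V i ->
    exists2 i, i \in l & (hausdorff_dim B <= hausdorff_dim (B `&` V i))%E.
  exact: H.
elim: l B => // i l ihl B _ BV; have [l0|l0] := eqVneq l [::].
  exists i; rewrite ?mem_head //; apply: hausdorff_dim_sub => x Bx.
  split=> //; have [j /=] := BV x Bx.
  by rewrite l0 inE => /eqP ->.
pose B' := B `&` \bigcup_(i in [set` l]) V i.
have BU : B `<=` (B `&` V i) `|` B'.
  move=> x Bx; have [j /=] := BV x Bx.
  rewrite inE => /predU1P[->|jl] Vj; [by left|right].
  by split=> //; exists j.
have := le_trans (hausdorff_dim_sub _ _ BU) (hausdorff_dimU _ _).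
rewrite le_max => /orP[Bi|BB']; first by exists i; rewrite ?mem_head.
have [||j jl jB'] := ihl B' => //; first exact: subIsetr.
exists j; first by rewrite inE jl orbT.
apply: le_trans BB' (le_trans jB' _); apply: hausdorff_dim_sub.
by move=> x [[Bx _] Vx].
Qed.

(** Finitely many balls of radius [r] cover [A], and by finite stability one of them carries its
    dimension. The radius is prescribed before [p], so it can be adapted to the separation
    constant. *)
Lemma hausdorff_dim_local (r : R) A : A !=set0 -> compact A -> 0 < r ->
  exists2 p, A p &
    (hausdorff_dim A <= hausdorff_dim (A `&` [set x | (enorm (p - x) < r)%R]))%E.
Proof.
move=> [a Aa] + r0; rewrite compact_cover => cA.
pose V p := [set x : 'rV[R]_d | enorm (p - x) < r].
have [||D DA AD] := cA _ A (fun p => interior (V p)).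
- by move=> p _; exact: open_interior.
- move=> x Ax; exists x => //; apply/interiorP_enorm; by exists r.
have [|x Ax|p pD Ap] := hausdorff_dim_finite_cover (finmap.enum_fset D) V A.
- have [p /= pD _] := AD a Aa; apply/eqP => D0.
  by have : p \in finmap.enum_fset D by []; rewrite D0.
- have [p pD Vx] := AD x Ax; exists p => //; exact: (interior_subset Vx).
by exists p => //; apply: set_mem; exact: DA.
Qed.

End Dimension.

(** * The unit cube and its faces *)

Section Cube.
Context {R : realType} {d : nat}.
Implicit Types (s : R) (x y : 'rV[R]_d) (A : set 'rV[R]_d).

Local Notation cube := (@cube R d).

Lemma cube_closed : closed cube.
Proof.
apply/closedP_enorm => x xQ i; apply/andP; split; apply/ler_addgt0Pr => e e0;
  have [y /(_ i) /andP[y0 y1] xy] := xQ e e0;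
  have := le_lt_trans (enorm_coord (x - y) i) xy;
  by rewrite !mxE ltr_norml => /andP[]; lra.
Qed.

Lemma cube_dist x y : cube x -> cube y -> enorm (x - y) <= d%:R.
Proof.
move=> Qx Qy; rewrite -[leRHS]mulr1; apply: enorm_le_coord => i; rewrite !mxE.
by have /andP[? ?] := Qx i; have /andP[? ?] := Qy i; rewrite ler_norml; lra.
Qed.

Lemma cube_bounded x : cube x -> enorm x <= d%:R.
Proof.
move=> Qx; rewrite -[x]subr0; apply: cube_dist => // i.
by rewrite mxE lexx ler01.
Qed.

Lemma interior_cube x : (forall i, 0 < x 0 i < 1) -> interior cube x.
Proof.
move=> x01; apply/interiorP_enorm.
pose e := \big[Num.min/1]_(i < d) Num.min (x 0 i) (1 - x 0 i).
exists e.
  apply: lt_bigmin => // i _; have /andP[? ?] := x01 i.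
  by rewrite lt_min subr_gt0; apply/andP.
move=> y xy i; have ei : e <= Num.min (x 0 i) (1 - x 0 i).
  exact: bigmin_le.
have := le_lt_trans (enorm_coord (x - y) i) (lt_le_trans xy ei).
by rewrite !mxE lt_min !ltr_norml => /andP[/andP[? ?] /andP[? ?]]; lra.
Qed.

Definition cube_face (i : 'I_d) (b : R) := cube `&` [set x | x 0 i = b].

(* N^(d-1) boxes of side 1/N cover a face. *)
Lemma hnull_cube_face s i b : d%:R - 1 < s -> hnull s (cube_face i b).
Proof.
move=> ds; apply: hnull_finite => delta e delta0 e0.
have d0 : (0 < d)%N by exact: leq_ltn_trans (ltn_ord i).
(* The total weight is N^(d-1) (d/N)^s = d^s N^(-t). Hence the two lower bounds on N below: d/delta
   for the diameters and (C/e)^(1/t) for the weight. *)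
pose t := s - (d%:R - 1); have t0 : 0 < t by rewrite subr_gt0.
have dR : 0 < d%:R :> R by rewrite ltr0n.
pose C : R := d%:R `^ s; have C0 : 0 < C by exact: powR_gt0.
have [N [N0 Nd Ne]] : exists N : nat,
    [/\ (0 < N)%N, d%:R / N%:R <= delta & C * N%:R `^ (- t) <= e].
  pose x : R := Num.max (d%:R / delta) ((C / e) `^ t^-1).
  exists (Num.truncn x).+1.
  have xN : x < (Num.truncn x).+1%:R by exact: truncnS_gt.
  move: xN; set N := (_).+1 => xN; have N0 : 0 < N%:R :> R by rewrite ltr0n.
  move: xN; rewrite gt_max => /andP[/ltW dN /ltW CN].
  split=> //; first by rewrite ler_pdivrMr // mulrC -ler_pdivrMr.
  have := ge0_ler_powR (ltW t0) _ _ CN; rewrite !nnegrE powR_ge0 (ltW N0).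
  move=> /(_ isT isT); rewrite -powRrM mulVf ?gt_eqF // powRr1; last first.
    by rewrite divr_ge0 // ltW.
  rewrite powRN ler_pdivrMr // => h.
  by rewrite ler_pdivrMr ?powR_gt0 // mulrC.
have NR : 0 < N%:R :> R by rewrite ltr0n.
pose I := {ffun {j : 'I_d | j != i} -> 'I_N}.
pose V (f : I) : set 'rV[R]_d := [set x | x 0 i = b /\
   forall j : {j : 'I_d | j != i},
     (f j)%:R / N%:R <= x 0 (val j) <= (f j).+1%:R / N%:R].
exists I, V, (d%:R / N%:R); split.
- move=> x [Qx xb].
  have /fin_all_exists[f fP] : forall j : {j : 'I_d | j != i}, exists k : 'I_N,
      k%:R / N%:R <= x 0 (val j) <= k.+1%:R / N%:R.
    move=> j; have /andP[x0 x1] := Qx (val j).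
    have [xN|xN] := ltP (x 0 (val j)) 1.
      have y0 : 0 <= x 0 (val j) * N%:R by rewrite mulr_ge0 // ltW.
      have kN : (Num.truncn (x 0 (val j) * N%:R)%R < N)%N.
        by rewrite truncn_lt_nat // -[ltRHS]mul1r ltr_pM2r.
      exists (Ordinal kN) => /=; have := truncn_itv y0.
      by rewrite ler_pdivrMr // ler_pdivlMr // => /andP[-> /ltW ->].
    (* The coordinate 1 goes to the last closed interval, since truncation would give the index
       N. *)
    have kN : (N.-1 < N)%N by rewrite prednK.
    exists (Ordinal kN) => /=; rewrite prednK // divff ?gt_eqF // x1 andbT.
    by apply: le_trans xN; rewrite ler_pdivrMr // mul1r ler_nat leq_pred.
  exists (finfun f) => //; split=> // j; rewrite ffunE; exact: fP.
- by rewrite Nd andbT divr_ge0.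
- move=> f x y [xb Vx] [yb Vy]; apply: enorm_le_coord => j; rewrite !mxE.
  have [->|ji] := eqVneq j i; first by rewrite xb yb subrr normr0 invr_ge0.
  have := Vx (exist _ j ji); have := Vy (exist _ j ji) => /=.
  rewrite -!natr1 !mulrDl mul1r ler_norml => /andP[? ?] /andP[? ?].
  by apply/andP; split; lra.
- rewrite card_ffun card_ord card_sig.
  have -> : #|[pred j | j != i]| = d.-1.
    have := cardC1 i; rewrite card_ord => <-; exact: eq_card.
  rewrite powRM // ?invr_ge0 // mulrCA; apply: le_trans Ne.
  rewrite ler_pM2l // natrX -powR_mulrn // -powR_inv1 // -powRrM -powRD.
    rewrite le_eqVlt; apply/orP; left; apply/eqP; congr powR.
    by rewrite -subn1 natrB // /t; lra.
  by apply/implyP => _; rewrite gt_eqF.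
Qed.

(** What lies outside the open cube sits on the 2d faces, which are null at every exponent above d -
    1. A dimension above d - 1 is thus already seen in the open cube. *)
Lemma hausdorff_dim_cube_interior A : (0 < d)%N -> A `<=` cube ->
  (hausdorff_dim A <= maxe (hausdorff_dim (A `&` interior cube)) (d%:R - 1)%:E)%E.
Proof.
move=> d0 AQ; apply: hausdorff_dim_le.
  by rewrite le_max hausdorff_dim_ge0.
move=> s; rewrite gt_max => /andP[/hnull_dim_lt nA]; rewrite lte_fin => ds.
apply: (hnull_sub _ _ ((A `&` interior cube) `|`
    \bigcup_(i in [set` enum 'I_d]) (cube_face i 0 `|` cube_face i 1))).
  move=> x Ax; have Qx := AQ x Ax.
  have [x01|/existsNP[i xi]] := pselect (forall i, 0 < x 0 i < 1).
    by left; split=> //; exact: interior_cube.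
  right; exists i; first by rewrite /= mem_enum.
  have /andP[] := Qx i; rewrite le_eqVlt => /predU1P[x0|x0]; first by left; split.
  rewrite le_eqVlt => /predU1P[x1|x1]; first by right; split.
  by exfalso; apply: xi; rewrite x0.
by apply/hnullU/hnull_bigcup => // i; apply: hnullU; exact: hnull_cube_face.
Qed.

End Cube.

(** * Compact sets and free ultrafilters on the naturals *)

Section CompactSets.
Context {R : realType} {d : nat}.
Implicit Types (A B : set 'rV[R]_d).

Lemma similarity_compact (r : R) f A :
  similarity r f -> compact A -> compact (f @` A).
Proof.
move=> fr /compactP_enorm[[M AM] /closedP_enorm cA].
have [g [r0 gr] [gK fK]] := similarity_inv _ _ fr.
apply/compactP_enorm; split.
  exists (r * M + enorm (f 0)) => _ [x Ax <-].
  have := ler_enormD (f x - f 0) (f 0); rewrite subrK (similarityE _ _ fr) subr0.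
  have := AM x Ax; rewrite -(ler_pM2l (similarity_gt0 fr)); lra.
apply/closedP_enorm => x xA; exists (g x); last exact: gK.
apply: cA => e e0.
have [_ [a Aa <-] xa] := xA (r * e) (mulr_gt0 (similarity_gt0 fr) e0).
exists a => //; rewrite -(fK a) gr -(ltr_pM2l (similarity_gt0 fr)) mulrA.
by rewrite divff ?mul1r // gt_eqF // (similarity_gt0 fr).
Qed.

Lemma ultrafilter_nat : exists2 U : set_system nat, UltraFilter U &
  forall N, \forall n \near U, (N <= n)%N.
Proof.
have [U [UU oU]] := ultraFilterLemma eventually_filter.
by exists U => // N; apply: oU; exists N.
Qed.

Lemma ultra_invS (U : set_system nat) {UU : UltraFilter U} (e : R) :
  (forall N, \forall n \near U, (N <= n)%N) -> 0 < e ->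
  \forall n \near U, n.+1%:R^-1 < e.
Proof.
move=> oU e0; apply: filterS (oU (Num.truncn e^-1)) => n en.
rewrite -[ltRHS]invrK ltf_pV2 ?posrE ?invr_gt0 //.
by apply: lt_le_trans (truncnS_gt _) _; rewrite ler_nat.
Qed.

Lemma compact_dist_gt0 A B : compact A -> closed B -> A `&` B = set0 ->
  exists2 c : R, 0 < c & forall x y, A x -> B y -> c <= enorm (x - y).
Proof.
move=> /compactP_enorm[[M AM] cA] cB AB0; apply: contrapT => nc.
have /choice[p pP] : forall n, exists p : 'rV[R]_d * 'rV[R]_d,
    [/\ A p.1, B p.2 & enorm (p.1 - p.2) < n.+1%:R^-1].
  move=> n; apply: contrapT => np; apply: nc; exists n.+1%:R^-1.
    by rewrite invr_gt0.
  move=> x y Ax By; rewrite leNgt; apply/negP => xy.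
  by apply: np; exists (x, y).
have [U UU oU] := ultrafilter_nat.
have [|x px] := ultra_bounded_cvg U (fun n => (p n).1) M.
  by apply: nearW => n; apply: AM; case: (pP n).
have Ax : A x.
  apply: (iffLR (closedP_enorm _) cA) => e e0.
  by have [n xn] := filter_ex (px e e0); exists (p n).1 => //; case: (pP n).
have Bx : B x.
  apply: (iffLR (closedP_enorm _) cB) => e e0; have e20 : 0 < e / 2 by lra.
  have [n [xn ne]] := filter_ex (filterI (px _ e20) (ultra_invS U _ oU e20)).
  have [_ Bn pn] := pP n; exists (p n).2 => //.
  apply: le_lt_trans (ler_enormB (p n).1 _ _) _; rewrite [ltRHS]splitr ltrD //.
  exact: lt_trans pn ne.
by have : (A `&` B) x by []; rewrite AB0.
Qed.

End CompactSets.

(** * Infinite words, the coding map, the attractor and separation of pieces *)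

Lemma mkseq_add {T : Type} (f : nat -> T) m n :
  mkseq f (m + n) = mkseq f m ++ mkseq (fun k => f (m + k)%N) n.
Proof. by rewrite /mkseq iotaD map_cat add0n -{2}[m]addn0 iotaDl -map_comp. Qed.

Lemma mkseq_cons {T : Type} (f : nat -> T) n :
  mkseq f n.+1 = f 0%N :: mkseq (fun k => f k.+1) n.
Proof. exact: (mkseq_add f 1 n). Qed.

Section CodingMap.
Context {R : realType} {d : nat} {L : finType}.
Variables (Phi : L -> 'rV[R]_d -> 'rV[R]_d) (rho : L -> R).
Hypothesis L_gt0 : (0 < #|L|)%N.
Hypothesis rho_lt1 : forall i, rho i < 1.
Hypothesis PhiP : forall i, similarity (rho i) (Phi i).
Implicit Types (v w : seq L) (i : nat -> L) (x y : 'rV[R]_d).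

Local Notation K := (attractor Phi).

Definition word_ratio w : R := \prod_(i <- w) rho i.

Lemma word_ratio_gt0 w : 0 < word_ratio w.
Proof. by apply: prodr_gt0 => i _; exact: similarity_gt0 (PhiP i). Qed.

Lemma word_map_similarity w : similarity (word_ratio w) (word_map Phi w).
Proof.
elim: w => [|a w ihw]; first by rewrite /word_ratio big_nil; exact: similarity_id.
by rewrite /word_ratio big_cons; exact: similarity_comp (PhiP a) ihw.
Qed.

Lemma word_map_cat v w x : word_map Phi (v ++ w) x = word_map Phi v (word_map Phi w x).
Proof. by rewrite /word_map foldr_cat. Qed.

(** A default inside (0,1) keeps the maximum there. *)
Definition max_ratio : R := \big[Num.max/2^-1]_(i : L) rho i.

Lemma max_ratio_itv : 0 < max_ratio < 1.
Proof.
apply/andP; split.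
  by apply: lt_le_trans (bigmax_ge_id _ _ _ _); rewrite invr_gt0.
apply: bigmax_lt => [|i _]; last exact: rho_lt1.
by rewrite invf_lt1 // ltr1n.
Qed.

Lemma word_ratio_le w : word_ratio w <= max_ratio ^+ size w.
Proof.
rewrite /word_ratio; elim: w => [|a w ihw]; first by rewrite big_nil.
rewrite big_cons exprS ler_pM // ?(ltW (word_ratio_gt0 w)) //.
  exact: ltW (similarity_gt0 (PhiP a)).
exact: le_bigmax.
Qed.

Lemma word_ratio_le1 w : word_ratio w <= 1.
Proof.
apply: le_trans (word_ratio_le w) _; have /andP[q0 q1] := max_ratio_itv.
by rewrite exprn_ile1 // ltW.
Qed.

Lemma max_ratio_small (M e : R) : 0 < e ->
  exists N, forall n, (N <= n)%N -> max_ratio ^+ n * M < e.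
Proof.
move=> e0; have /andP[q0 q1] := max_ratio_itv.
have : max_ratio ^+ n * M @[n --> \oo] --> 0.
  rewrite -(mul0r M); apply: cvgM; last exact: cvg_cst.
  by apply: cvg_expr; rewrite ger0_norm // ltW.
move=> /cvgrPdist_lt /(_ e e0) [N _ Ne]; exists N => n Nn.
by have := Ne n Nn; rewrite /= sub0r normrN; apply: le_lt_trans; exact: ler_norm.
Qed.

(** With q the largest ratio and C a bound on all [Phi a 0], the constant solves M = q M + C, so
    prepending a letter preserves the bound. *)
Lemma word_map_bounded : exists2 M : R, 0 <= M &
  forall w, enorm (word_map Phi w 0) <= M.
Proof.
have /andP[q0 q1] := max_ratio_itv.
pose C := \big[Num.max/0]_(i : L) enorm (Phi i 0).
have C0 : 0 <= C by exact: bigmax_ge_id.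
pose M := C / (1 - max_ratio); have M0 : 0 <= M by rewrite divr_ge0 // subr_ge0 ltW.
exists M => //; elim=> [|a w ihw]; first by rewrite enorm0.
have aC : enorm (Phi a 0) <= C by exact: le_bigmax.
have := ler_enormD (Phi a (word_map Phi w 0) - Phi a 0) (Phi a 0).
rewrite subrK (similarityE _ _ (PhiP a)) subr0 => /le_trans; apply.
have aq : rho a <= max_ratio by exact: le_bigmax.
have -> : M = max_ratio * M + C.
  by rewrite /M; field; rewrite subr_eq0 eq_sym lt_eqF.
apply: lerD => //; apply: ler_pM => //; first exact: ltW (similarity_gt0 (PhiP a)).
exact: enorm_ge0.
Qed.

(** [lim] is meaningful only once convergence is known: an ultralimit of the bounded orbit of 0 is
    taken first, and the tail estimate shows that it is the limit. The rate is uniform in the code,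
    and any base point may replace 0. *)
Lemma coding_map_rate : exists2 M : R, 0 <= M & forall i n x,
  enorm (coding_map Phi i - word_map Phi (mkseq i n) x) <=
    max_ratio ^+ n * (M + enorm x).
Proof.
have /andP[q0 q1] := max_ratio_itv; have [M M0 wM] := word_map_bounded.
exists M => // i; pose u n := word_map Phi (mkseq i n) 0.
have [U UU oU] := ultrafilter_nat.
have [|l ul] := ultra_bounded_cvg U u M.
  by apply: nearW => n; exact: wM.
have ratio_n n : word_ratio (mkseq i n) <= max_ratio ^+ n.
  by rewrite -{2}(size_mkseq i n) word_ratio_le.
have lu n : enorm (l - u n) <= max_ratio ^+ n * M.
  apply/ler_addgt0Pr => e e0; have [m [nm lm]] := filter_ex (filterI (oU n) (ul e e0)).
  apply: le_trans (ler_enormB (u m) _ _) _; rewrite addrC lerD ?(ltW lm) //.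
  rewrite /u -(subnKC nm) mkseq_add word_map_cat.
  rewrite (similarityE _ _ (word_map_similarity _)) subr0.
  by rewrite ler_pM ?enorm_ge0 // ltW // word_ratio_gt0.
have -> : coding_map Phi i = l.
  apply: (@cvg_lim _ (@norm_hausdorff _ _)) => A /nbhs_enormP[e e0 eA].
  have [N Ne] := max_ratio_small M _ e0; exists N => // n /= Nn.
  by apply: eA; apply: le_lt_trans (lu n) (Ne n Nn).
move=> n x; apply: le_trans (ler_enormB (u n) _ _) _; rewrite mulrDr lerD //.
rewrite /u (similarityE _ _ (word_map_similarity _)) enormBC subr0.
by rewrite ler_wpM2r ?enorm_ge0.
Qed.

Lemma coding_map_shift i :
  coding_map Phi i = Phi (i 0%N) (coding_map Phi (fun k => i k.+1)).
Proof.
have [M M0 cM] := coding_map_rate; have /andP[q0 q1] := max_ratio_itv.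
apply/eqP; rewrite -subr_eq0; apply/eqP/enorm_eq0/le_anti; rewrite enorm_ge0 andbT.
apply/ler_addgt0Pr => e e0; rewrite add0r.
have [N /(_ N (leqnn N)) Ne] := max_ratio_small (M + M) _ e0; apply: le_trans (ltW Ne).
apply: le_trans (ler_enormB (word_map Phi (mkseq i N.+1) 0) _ _) _.
rewrite mulrDr; apply: lerD.
  have := cM i N.+1 0; rewrite enorm0 addr0 => /le_trans; apply.
  by rewrite ler_wpM2r // exprS ler_piMl ?exprn_ge0 // ltW.
rewrite mkseq_cons /= enormBC (similarityE _ _ (PhiP _)).
have := cM (fun k => i k.+1) N 0; rewrite enorm0 addr0; apply: le_trans.
by rewrite ler_piMl ?enorm_ge0 // ltW.
Qed.

Lemma coding_map_prefix i n :
  coding_map Phi i = word_map Phi (mkseq i n) (coding_map Phi (fun k => i (n + k)%N)).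
Proof.
elim: n i => [|n ihn] i //.
by rewrite coding_map_shift mkseq_cons /= ihn.
Qed.

Lemma coding_map_in (A : set 'rV[R]_d) i : A !=set0 -> closed A ->
  (forall a x, A x -> A (Phi a x)) -> A (coding_map Phi i).
Proof.
move=> [x Ax] cA AP; have [M M0 cM] := coding_map_rate.
apply: (iffLR (closedP_enorm _) cA) => e e0.
have [N /(_ N (leqnn N)) Ne] := max_ratio_small (M + enorm x) _ e0.
exists (word_map Phi (mkseq i N) x); last exact: le_lt_trans (cM i N x) Ne.
by elim: (mkseq i N) => //= a w; exact: AP.
Qed.

(* The closure of the orbit of the fixed point of one of the maps. *)
Lemma attractor_ex : exists A, is_attractor Phi A.
Proof.
have /card_gt0P[a0 _] := L_gt0.
pose p := coding_map Phi (fun=> a0); have pE : Phi a0 p = p.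
  by rewrite {2}/p coding_map_shift.
pose O := [set word_map Phi w p | w in [set: seq L]].
have cK : compact (closure O).
  apply/compactP_enorm; split; last exact: closed_closure.
  have [M M0 wM] := word_map_bounded; exists (enorm p + M + 1) => x /closureP_enorm.
  move=> /(_ 1 ltr01)[_ [w _ <-] xw].
  have := ler_enormD (x - word_map Phi w p) (word_map Phi w p).
  have := ler_enormD (word_map Phi w p - word_map Phi w 0) (word_map Phi w 0).
  rewrite !subrK (similarityE _ _ (word_map_similarity w)) subr0.
  have := ler_wpM2r (enorm_ge0 p) (word_ratio_le1 w).
  by have := wM w; lra.
have KP a x : closure O x -> closure O (Phi a x).
  move=> /closureP_enorm Ox; apply/closureP_enorm => e e0.
  have [_ [w _ <-] xw] := Ox e e0; exists (word_map Phi (a :: w) p).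
    by exists (a :: w).
  rewrite /= (similarityE _ _ (PhiP a)); apply: le_lt_trans xw.
  by rewrite ler_piMl ?enorm_ge0 // ltW.
exists (closure O); split.
  split=> //; exists p; apply: subset_closure; by exists [::].
apply/seteqP; split=> [|x [a _ [y Ky <-]]]; last exact: KP.
(* A finite union of compact images is closed, so only the orbit has to be checked. There the empty
   word gives [p], which is [Phi a0 p]: the reason for starting from a fixed point. *)
have -> : \bigcup_a Phi a @` closure O = closure (\bigcup_a Phi a @` closure O).
  apply/closure_id; apply: closed_bigcup => [|a _].
    exact: finite_finset.
  apply: compact_closed; first exact: norm_hausdorff.
  exact: similarity_compact (PhiP a) cK.
apply: closure_subset => _ [w _ <-]; case: w => [|a w].
  exists a0 => //; exists p; last exact: pE.
  by apply: subset_closure; exists [::].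
by exists a => //; exists (word_map Phi w p) => //; apply: subset_closure; exists w.
Qed.

Lemma attractorP : is_attractor Phi K.
Proof. exact: xgetPex attractor_ex. Qed.

Lemma attractor_Phi a x : K x -> K (Phi a x).
Proof. by move=> Kx; have [_ ->] := attractorP; exists a => //; exists x. Qed.

Lemma coding_map_attractor i : K (coding_map Phi i).
Proof.
have [[K0 cK] _] := attractorP; apply: coding_map_in => //; last exact: attractor_Phi.
by apply: compact_closed => //; exact: norm_hausdorff.
Qed.

Lemma tree_set_attractor T : tree_set Phi T `<=` K.
Proof. by move=> _ [i _ <-]; exact: coding_map_attractor. Qed.

Lemma attractor_bounded : exists M : R, forall x, K x -> enorm x <= M.
Proof. by have [[_ /compactP_enorm[KM _]] _] := attractorP. Qed.

Lemma SSC_separation : SSC Phi -> exists2 c : R, 0 < c &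
  forall a b x y, a != b -> K x -> K y -> c <= enorm (Phi a x - Phi b y).
Proof.
move=> ssc; have [[_ cK] _] := attractorP.
have /choice[c cP] : forall p : L * L, exists c : R, 0 < c /\
    (p.1 != p.2 -> forall x y, K x -> K y -> c <= enorm (Phi p.1 x - Phi p.2 y)).
  move=> [a b] /=; have [->|ab] := eqVneq a b; first by exists 1.
  have Kim e : compact (Phi e @` K) by exact: similarity_compact (PhiP e) cK.
  have [|c c0 cK'] := compact_dist_gt0 _ _ (Kim a) _ (ssc a b ab).
    by apply: compact_closed => //; exact: norm_hausdorff.
  exists c; split=> // _ x y Kx Ky; apply: cK'; by [exists x|exists y].
pose c0 := \big[Num.min/1]_p c p; exists c0.
  by apply: lt_bigmin => // p _; case: (cP p).
move=> a b x y ab Kx Ky; have c0ab : c0 <= c (a, b) by exact: bigmin_le.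
by apply: le_trans c0ab _; case: (cP (a, b)) => _; exact.
Qed.

(** At the first letter where [i] leaves [v], the points lie in distinct first-level pieces, [c]
    apart, shrunk by the ratio of the common prefix; that ratio is at least [word_ratio v]. *)
Lemma word_separation (c : R) : 0 < c ->
  (forall a b x y, a != b -> K x -> K y -> c <= enorm (Phi a x - Phi b y)) ->
  forall v i y, K y -> mkseq i (size v) = v \/
    c * word_ratio v <= enorm (coding_map Phi i - word_map Phi v y).
Proof.
move=> c0 cP; elim=> [|a v ihv] i y Ky; first by left.
rewrite /= mkseq_cons coding_map_shift.
have Kv : K (word_map Phi v y).
  by elim: (v) => //= b w; exact: attractor_Phi.
have [->|ia] := eqVneq (i 0%N) a; last first.
  right; apply: le_trans (cP _ _ _ _ ia (coding_map_attractor _) Kv).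
  by rewrite ler_piMr ?word_ratio_le1 // ltW.
have [->|h] := ihv (fun k => i k.+1) y Ky; first by left.
right; rewrite /word_ratio big_cons (similarityE _ _ (PhiP a)) mulrCA.
by rewrite ler_pM2l // (similarity_gt0 (PhiP a)).
Qed.

Section Pieces.
Variables (T : set (seq L)) (T_tree : is_tree T).

Lemma word_map_piece v : T v ->
  word_map Phi v @` tree_set Phi (subtree T v) `<=` tree_set Phi T.
Proof.
move=> Tv _ [_ [i Ti <-] <-].
(* The word [v] followed by [i]: the default of [nth] takes over beyond the end of [v]. *)
pose j n := nth (i (n - size v)%N) v n.
have jv : mkseq j (size v) = v.
  apply: (@eq_from_nth _ (i 0%N)); rewrite size_mkseq // => n nv.
  by rewrite nth_mkseq // /j; exact: set_nth_default.
have ji : (fun k => j (size v + k)%N) = i.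
  by apply/funext => k; rewrite /j addKn nth_default // leq_addr.
exists j; last by rewrite (coding_map_prefix j (size v)) jv ji.
move=> n; apply: T_tree.2 (Ti n); have -> : v ++ mkseq i n = mkseq j (size v + n).
  by rewrite mkseq_add jv ji.
by rewrite addnC mkseq_add prefix_prefix.
Qed.

Lemma piece_of_prefix i n : tree_boundary T i ->
  tree_set Phi (subtree T (mkseq i n)) (coding_map Phi (fun k => i (n + k)%N)).
Proof.
move=> Ti; exists (fun k => i (n + k)%N) => // m.
by rewrite /subtree /= -mkseq_add.
Qed.

Lemma piece_separation (c : R) : 0 < c ->
  (forall a b x y, a != b -> K x -> K y -> c <= enorm (Phi a x - Phi b y)) ->
  forall v y z, K y -> tree_set Phi T z ->
    (exists2 s, tree_set Phi (subtree T v) s & z = word_map Phi v s) \/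
    c * word_ratio v <= enorm (z - word_map Phi v y).
Proof.
move=> c0 cP v y _ Ky [i Ti <-].
have [iv|] := word_separation c c0 cP v i y Ky; last by right.
left; exists (coding_map Phi (fun k => i (size v + k)%N)).
  by rewrite -{1}iv; exact: piece_of_prefix.
by rewrite -{1}iv -coding_map_prefix.
Qed.

End Pieces.

End CodingMap.

(** * Ultralimits of minisets are microsets *)

Section Microsets.
Context {R : realType} {d : nat}.
Implicit Types (F A : set 'rV[R]_d).

Lemma similarity_affine (N : R) (a b : 'rV[R]_d) : 0 < N ->
  similarity N (fun x => N *: (x - a) + b).
Proof.
move=> N0; split=> // x y.
have -> : N *: (x - a) + b - (N *: (y - a) + b) = N *: (x - y).
  by rewrite opprD addrACA subrr addr0 -scalerBr opprB addrA subrK.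
by rewrite enormZ gtr0_norm.
Qed.

Lemma hausdorff_dim_set0 : hausdorff_dim (set0 : set 'rV[R]_d) = 0%E.
Proof.
apply/le_anti; rewrite hausdorff_dim_ge0 andbT; apply: hnull_dim_le => //.
by apply: hnull_sub (hnull_bigcup ([::] : seq void) (fun=> set0) 0 _).
Qed.

Lemma ulim_microset (U : set_system nat) {UU : UltraFilter U} F
    (B : nat -> set 'rV[R]_d) : (forall n, B n `<=` cube) ->
  (\forall n \near U, miniset F (B n)) -> microset F (ulim U B).
Proof.
move=> BQ FB; have Bd n y : B n y -> enorm y <= d%:R.
  by move=> /BQ; exact: cube_bounded.
split.
  split; last exact: ulim_compact Bd.
  by apply: ulim_nonempty Bd _; apply: filterS FB => n [].
(* Picking one index for each tolerance 1/(n+1) turns the ultralimit into an ordinary limit; indices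
   may repeat, since a microset is a limit of any sequence of minisets. *)
have /choice[k kP] : forall n, exists k, miniset F (B k) /\
    (hausdorff_dist (B k) (ulim U B) <= (n.+1%:R^-1)%:E)%E.
  move=> n; have n0 : 0 < n.+1%:R^-1 :> R by rewrite invr_gt0.
  by have [k ?] := filter_ex (filterI FB (hausdorff_dist_ulim U _ _ _ Bd n0)); exists k.
exists (B \o k); split=> [n|]; first by case: (kP n).
apply: (squeeze_cvge (f := fun=> 0%E) (h := fun n => (n.+1%:R^-1)%:E)).
- by apply: nearW => n /=; rewrite hausdorff_dist_ge0; case: (kP n).
- exact: cvg_cst.
- by apply: cvg_EFin; [exact: nearW|exact: cvg_harmonic].
Qed.

Lemma microset_near (U : set_system nat) {UU : UltraFilter U} A
    (B : nat -> set 'rV[R]_d) (e : R) :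
  (forall N, \forall n \near U, (N <= n)%N) ->
  hausdorff_dist (B n) A @[n --> \oo] --> 0%E -> 0 < e ->
  \forall n \near U, B n `<=` enlargement e A /\ A `<=` enlargement e (B n).
Proof.
move=> oU BA e0; have [N _ Ne] : \forall n \near \oo, (hausdorff_dist (B n) A < e%:E)%E.
  apply: (BA [set y | (y < e%:E)%E]); apply: open_nbhs_nbhs; split.
    exact: open_ereal_lt_ereal.
  by rewrite /= lte_fin.
by apply: filterS (oU N) => n /Ne; exact: hausdorff_dist_lt.
Qed.

End Microsets.

(** * Transfer between microsets of F and limits of pieces *)

Section TreeMicrosets.
Context {R : realType} {d : nat} {L : finType}.
Variables (Phi : L -> 'rV[R]_d -> 'rV[R]_d) (rho : L -> R).
Hypothesis d_gt0 : (0 < d)%N.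
Hypothesis L_gt0 : (0 < #|L|)%N.
Hypothesis rho_lt1 : forall i, rho i < 1.
Hypothesis PhiP : forall i, similarity (rho i) (Phi i).
Variables (T : set (seq L)) (T_tree : is_tree T) (c : R).
Hypothesis c_gt0 : 0 < c.
Hypothesis c_sep : forall a b x y, a != b -> attractor Phi x -> attractor Phi y ->
  c <= enorm (Phi a x - Phi b y).

Local Notation F := (tree_set Phi T).
Local Notation Q := (@cube R d).
Local Notation piece v := (tree_set Phi (subtree T v)).

(* When h magnifies the separation constant c beyond the diameter of the cube,
   the cube meets only the magnified piece. *)
Lemma interior_microset_window S (r : R) h :
  hausdorff_closure (tree_pieces Phi T) S -> similarity r h -> 1 <= r ->
  d%:R < r * c -> (h @` S `&` interior Q) !=set0 ->
  exists A, [/\ interior_microsets F A, h @` S `&` interior Q `<=` A &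
    A `<=` Q `&` h @` S].
Proof.
move=> [[S0 cS] SC] hr r1 dc [q0 hq0].
have r0 := similarity_gt0 hr.
have /choice[v vP] : forall n, exists v, T v /\
    (hausdorff_dist (piece v) S < (n.+1%:R^-1)%:E)%E.
  move=> n; have n0 : 0 < n.+1%:R^-1 :> R by rewrite invr_gt0.
  by have [_ [v Tv <-] ?] := SC _ n0; exists v.
have /choice[g gP] : forall n, exists g, similarity (word_ratio rho (v n))^-1 g /\
    cancel (word_map Phi (v n)) g.
  move=> n; have [g gs [_ gK]] :=
    similarity_inv _ _ (word_map_similarity _ _ PhiP (v n)).
  by exists g.
pose B n := Q `&` (h \o g n) @` F.
have [U UU oU] := ultrafilter_nat.
have BQ n : B n `<=` Q by move=> x [].
have pieceB n s : piece (v n) s -> Q (h s) -> B n (h s).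
  move=> Ds Qs; split=> //; exists (word_map Phi (v n) s) => /=.
    by apply: word_map_piece => //; [exact: (vP n).1|exists s].
  by rewrite (gP n).2.
have near_inv e : 0 < e -> \forall n \near U, r * n.+1%:R^-1 < e.
  move=> e0; apply: filterS (ultra_invS U _ oU (divr_gt0 e0 r0)) => n.
  by rewrite ltr_pdivlMr // mulrC.
(* A point of the open cube leaves room for nearby points of the n-th piece to land in the cube.
   This makes [B n] non-empty along [U] and supplies the anchor [s] used for separation below. *)
have near_hS q e : 0 < e -> (h @` S `&` interior Q) q ->
    \forall n \near U, exists s, [/\ piece (v n) s, Q (h s) & enorm (q - h s) < e].
  move=> e0 [[x Sx <-] /interiorP_enorm[e1 e10 Qe1]].
  have m0 : 0 < Num.min e e1 by rewrite lt_min e0 e10.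
  apply: filterS (near_inv _ m0) => n.
  have [_ /hausdorff_dist_lt[_ /(_ x Sx)[s Ds xs]]] := vP n.
  rewrite lt_min => /andP[ne ne1]; exists s.
  have hxs : enorm (h x - h s) <= r * n.+1%:R^-1.
    by rewrite (similarityE _ _ hr) ler_pM2l.
  by split=> //; [apply: Qe1|]; exact: le_lt_trans hxs _.
exists (ulim U B).
have SA : h @` S `&` interior Q `<=` ulim U B.
  move=> q hq e e0; apply: filterS (near_hS q e e0 hq) => n [s [Ds Qs qs]].
  by exists (h s) => //; exact: pieceB.
split=> //.
  split; last by exists q0; split; [exact: SA|exact: hq0.2].
  apply: ulim_microset => //; apply: filterS (near_hS q0 1 ltr01 hq0).
  move=> n [s [Ds Qs _]].
  split; first by exists (h s); exact: pieceB.
  exists (h \o g n) => //; exists (r * (word_ratio rho (v n))^-1); last first.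
    exact: similarity_comp hr (gP n).1.
  rewrite ler_pdivlMr ?(word_ratio_gt0 _ _ PhiP) // mul1r.
  exact: le_trans (word_ratio_le1 _ _ rho_lt1 PhiP _) r1.
move=> x Ax; split.
  by apply: (ulim_sub U _ _ cube_closed _ x Ax); exact: nearW.
have cl : closed (h @` S).
  apply: compact_closed; first exact: norm_hausdorff.
  exact: similarity_compact hr cS.
apply: (iffLR (closedP_enorm _) cl) => e e0; have e20 : 0 < e / 2 by exact: divr_gt0.
have [n [[[y [Qy [z Fz zy]] xy] ne] [s [Ds Qs _]]]] := filter_ex
  (filterI (filterI (Ax _ e20) (near_inv _ e20)) (near_hS q0 1 ltr01 hq0)).
have Ks := tree_set_attractor _ _ L_gt0 rho_lt1 PhiP _ _ Ds.
have [[s' Ds' zs']|zs] :=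
    piece_separation _ _ L_gt0 rho_lt1 PhiP T c c_gt0 c_sep (v n) s z Ks Fz.
  have [_ /hausdorff_dist_lt[/(_ s' Ds')[x' Sx' s'x'] _]] := vP n.
  exists (h x'); first by exists x'.
  apply: le_lt_trans (ler_enormB y _ _) _; rewrite [ltRHS]splitr ltrD //.
  rewrite -zy /= zs' (gP n).2 (similarityE _ _ hr); apply: le_lt_trans ne.
  by rewrite ler_pM2l.
(* Outside the n-th piece, [z] is at least c times the ratio of [v n] away from the anchor; [g n]
   undoes that ratio and [h] stretches the gap to at least r c > d, too much for two points of the
   cube. *)
exfalso; have := cube_dist _ _ Qy Qs; apply/negP; rewrite -ltNge.
apply: lt_le_trans dc _; rewrite -zy /= (similarityE _ _ hr) ler_pM2l //.
rewrite -[X in g n z - X]((gP n).2 s).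
rewrite (similarityE _ _ (gP n).1) mulrC ler_pdivlMr //.
exact: word_ratio_gt0 PhiP _.
Qed.

(** Chosen so that N c = c + d exceeds the diameter bound d, while N >= 1 keeps magnifications
    expanding. *)
Let N : R := 1 + d%:R / c.

Let N_ge1 : 1 <= N. Proof. by rewrite lerDl divr_ge0 // ltW. Qed.
Let N_gt0 : 0 < N. Proof. exact: lt_le_trans N_ge1. Qed.
Let N_c : d%:R < N * c.
Proof. by rewrite /N mulrDl mul1r divfK ?gt_eqF // ltrDr. Qed.

(** The map [h] centres the window at [p] and sends the ball of radius 1/(2N) into the open cube, so
    nothing is lost on the faces and no lower bound on the dimension appears. *)
Lemma dim_closure_interior_microset S : hausdorff_closure (tree_pieces Phi T) S ->
  exists2 A, interior_microsets F A & hausdorff_dim A = hausdorff_dim S.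
Proof.
move=> SC; have [[S0 cS] _] := SC; pose e := (2 * N)^-1.
have e0 : 0 < e by rewrite invr_gt0 mulr_gt0.
have [p Sp Sdim] := hausdorff_dim_local e S S0 cS e0.
pose h x := N *: (x - p) + const_mx 2^-1.
have hN : similarity N h by exact: similarity_affine.
have hQ x : enorm (p - x) < e -> interior Q (h x).
  move=> px; apply: interior_cube => i; rewrite !mxE.
  have := le_lt_trans (enorm_coord (p - x) i) px; rewrite !mxE.
  rewrite /e invfM -ltr_pdivrMr ?invr_gt0 // invrK => h1.
  have : `|N * (x 0 i - p 0 i)| < 2^-1.
    by rewrite normrM gtr0_norm // distrC mulrC.
  by rewrite ltr_norml => /andP[? ?]; lra.
have [|A [FA SA AS]] := interior_microset_window S N h SC hN N_ge1 N_c.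
  exists (h p); split; first by exists p.
  by apply: hQ; rewrite subrr enorm0.
exists A => //; apply/eqP; rewrite eq_le; apply/andP; split.
  rewrite -(hausdorff_dim_similarity _ _ S hN); apply: hausdorff_dim_sub.
  by move=> x /AS[].
apply: le_trans Sdim _; rewrite -(hausdorff_dim_similarity _ _ _ hN).
apply: hausdorff_dim_sub => _ [x [Sx px] <-]; apply: SA.
by split; [exists x|exact: hQ].
Qed.

(* A box of side 1/N inside the cube containing the part of the cube near p. *)
Lemma dim_closure_miniset S B : hausdorff_closure (tree_pieces Phi T) S ->
  miniset S B -> ((d%:R - 1)%:E < hausdorff_dim B)%E ->
  exists2 A, interior_microsets F A & hausdorff_dim A = hausdorff_dim B.
Proof.
move=> SC [B0 [f [r r1 fr] BE]] dB; have [[S0 cS] _] := SC.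
have cB : compact B.
  rewrite BE setIC; apply: compact_closedI; last exact: cube_closed.
  exact: similarity_compact fr cS.
pose e := (2 * N)^-1; have e0 : 0 < e by rewrite invr_gt0 mulr_gt0.
have eN : 2 * e = N^-1 by rewrite /e invfM mulrA divff ?mul1r.
have eN1 : 2 * e <= 1 by rewrite eN invf_le1.
have [p Bp Bdim] := hausdorff_dim_local e B B0 cB e0.
(* The lower corner of the box centred at [p], clamped so that the box stays in the cube; it still
   contains all points of the cube within [e] of [p]. *)
pose a : 'rV[R]_d := \row_i Num.max 0 (Num.min (p 0 i - e) (1 - 2 * e)).
have aP i : 0 <= a 0 i <= 1 - 2 * e.
  by rewrite mxE le_max lexx ge_max ge_min lexx orbT andbT subr_ge0.
pose g x := N *: (x - a) + 0; have gN : similarity N g by exact: similarity_affine.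
have QgE x : Q (g x) <-> forall i, a 0 i <= x 0 i <= a 0 i + 2 * e.
  suff H i : (0 <= g x 0 i <= 1) = (a 0 i <= x 0 i <= a 0 i + 2 * e).
    by split=> xP i; have := xP i; rewrite H.
  by rewrite !mxE addr0 pmulr_rge0 // subr_ge0 -lerBlDl eN -ler_pdivlMl // mulr1.
have Qball x : Q x -> enorm (p - x) < e -> Q (g x).
  move=> Qx px; apply/QgE => i; have := le_lt_trans (enorm_coord (p - x) i) px.
  have /andP[? ?] := Qx i; rewrite !mxE ltr_norml => /andP[? ?].
  rewrite ge_max ge_min -lerBlDr le_max le_min.
  apply/andP; split; first by apply/andP; split; [lra|apply/orP; left; lra].
  by apply/orP; right; apply/andP; split; lra.
have Qsub x : Q (g x) -> Q x.
  move=> /QgE xP i; have := xP i; have := aP i.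
  by move=> /andP[? ?] /andP[? ?]; apply/andP; split; lra.
pose C := Q `&` (g \o f) @` S.
have BC : g @` (B `&` [set x | enorm (p - x) < e]) `<=` C.
  move=> _ [x [Bx px] <-]; move: Bx; rewrite BE => -[Qx [s Ss sx]].
  by split; [exact: Qball|exists s; rewrite //= sx].
have CB : C `<=` g @` B.
  move=> y [Qy [s Ss sy]]; rewrite -sy /= in Qy *; exists (f s) => //.
  by rewrite BE; split; [exact: Qsub|exists s].
have BCdim : (hausdorff_dim B <= hausdorff_dim C)%E.
  apply: le_trans Bdim _; rewrite -(hausdorff_dim_similarity _ _ _ gN).
  exact: hausdorff_dim_sub.
(* [p] may lie on a face of the box, hence be sent to the boundary of the cube; the hypothesis on
   the dimension compensates for this. *)
have BCi : (hausdorff_dim B <= hausdorff_dim (C `&` interior Q))%E.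
  have := le_trans BCdim (hausdorff_dim_cube_interior C d_gt0 (@subIsetl _ _ _)).
  by rewrite le_max => /orP[//|Bd]; move: dB; rewrite ltNge Bd.
have [q [[Qq hq] Qiq]] : C `&` interior Q !=set0.
  apply/set0P/eqP => C0; move: dB; rewrite ltNge (le_trans BCi) // C0.
  by rewrite hausdorff_dim_set0 lee_fin subr_ge0 ler1n.
have [||||A [FA SA AS]] := interior_microset_window S (N * r) (g \o f) SC.
- exact: similarity_comp gN fr.
- by rewrite -[leLHS]mulr1 ler_pM.
- by apply: lt_le_trans N_c _; rewrite mulrAC -[leLHS]mulr1 ler_pM2l // mulr_gt0.
- by exists q.
exists A => //; apply/eqP; rewrite eq_le; apply/andP; split.
  rewrite -(hausdorff_dim_similarity _ _ B gN); apply: hausdorff_dim_sub.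
  exact: subset_trans CB.
apply: le_trans BCi _; apply: hausdorff_dim_sub => x [[_ hx] Qx].
exact: SA.
Qed.

Lemma min_ratio_ex : exists2 m : R, 0 < m & forall a, m <= rho a.
Proof.
pose m := \big[Num.min/1]_a rho a; exists m => [|a]; last exact: bigmin_le.
by apply: lt_bigmin => // a _; exact: similarity_gt0 (PhiP a).
Qed.

(* The longest prefix on which the magnification r is not yet undone. *)
Lemma prefix_scale (m : R) : 0 < m -> (forall a, m <= rho a) ->
  forall (i : nat -> L) (r : R), 1 <= r ->
  exists n, 1 <= r * word_ratio rho (mkseq i n) <= m^-1.
Proof.
move=> m0 mP i r r1; have r0 : 0 < r by exact: lt_le_trans r1.
(* Stated at [n.+1], so that the least witness is the length just before the product first drops
   below 1; for length 0 the product is [r]. *)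
pose P n := r * word_ratio rho (mkseq i n.+1) < 1.
have exP : exists n, P n.
  have [n /(_ n.+1 (leqnSn n)) Pn] := max_ratio_small _ rho_lt1 r 1 ltr01.
  exists n; apply: le_lt_trans Pn; rewrite mulrC ler_pM2r //.
  by rewrite -[in leRHS](size_mkseq i n.+1) (word_ratio_le _ _ PhiP).
case: (ex_minnP exP) => n Pn nmin; exists n; apply/andP; split.
  case: n Pn nmin => [_ _|n _ nmin]; first by rewrite /word_ratio big_nil mulr1.
  rewrite leNgt; apply/negP => Pn; by have := nmin n Pn; rewrite ltnn.
rewrite -[leRHS]mul1r ler_pdivlMr //; apply: le_trans (ltW Pn).
rewrite mkseqS -cats1 /word_ratio big_cat big_seq1 /= [leRHS]mulrA.
by rewrite ler_wpM2l ?mP // mulr_ge0 ?(ltW r0) // ltW // (word_ratio_gt0 _ _ PhiP).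
Qed.

(* Near a point p of locally full dimension, the magnified copies of F coincide
   with the single piece coded by a suitable prefix, magnified by a bounded ratio;
   both the pieces and the magnifications converge along an ultrafilter. *)
Lemma dim_microset_miniset A : interior_microsets F A ->
  ((d%:R - 1)%:E < hausdorff_dim A)%E ->
  exists B, (exists2 S, hausdorff_closure (tree_pieces Phi T) S & miniset S B) /\
    hausdorff_dim B = hausdorff_dim A.
Proof.
move=> [[[A0 cA] [B [FB BA]]] _] dA.
have [m m0 mP] := min_ratio_ex.
have [MK KM] := attractor_bounded _ _ L_gt0 rho_lt1 PhiP.
have clA : closed A by apply: compact_closed => //; exact: norm_hausdorff.
have c4 : 0 < c / 4 by rewrite divr_gt0.
(* A point y of the n-th miniset, a point x of A, [p] and the anchor of that miniset will be
   successively less than c/4 apart, so y and the anchor are closer than [c]. *)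
have [p Ap Adim] := hausdorff_dim_local (c / 4) A A0 cA c4.
have [U UU oU] := ultrafilter_nat.
have near_BA (e : R) : 0 < e ->
    \forall n \near U, B n `<=` enlargement e A /\ A `<=` enlargement e (B n).
  by move=> e0; exact: microset_near.
have /choice[f /choice[r fP]] : forall n, exists f, exists r : R,
    [/\ 1 <= r, similarity r f & B n = Q `&` f @` F].
  by move=> n; have [_ [f [r ? ?] ?]] := FB n; exists f, r.
(* The anchor of the n-th miniset: a point near [p] when there is one, otherwise any point. Lying in
   the cube for every n, it keeps the maps [g n] below bounded. *)
have /choice[i iP] : forall n, exists i, [/\ tree_boundary T i,
    Q (f n (coding_map Phi i)) &
    (exists2 y, B n y & enorm (p - y) < c / 4) ->
      enorm (p - f n (coding_map Phi i)) < c / 4].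
  move=> n; have BE y : B n y -> Q y /\
      exists2 i, tree_boundary T i & f n (coding_map Phi i) = y.
    case: (fP n) => _ _ -> [Qy [_ [i Ti <-] iy]]; by split=> //; exists i.
  have [[y By py]|np] := pselect (exists2 y, B n y & enorm (p - y) < c / 4).
    by have [Qy [i Ti iy]] := BE y By; exists i; rewrite iy.
  have [[y By] _] := FB n; have [Qy [i Ti iy]] := BE y By.
  by exists i; rewrite iy; split=> // ex; case: np.
have /choice[k kP] : forall n, exists k,
    1 <= r n * word_ratio rho (mkseq (i n) k) <= m^-1.
  by move=> n; apply: prefix_scale => //; case: (fP n).
pose v n := mkseq (i n) (k n).
have Tv n : T (v n) by case: (iP n) => + _ _; exact.
pose g n := f n \o word_map Phi (v n).
pose rg n := r n * word_ratio rho (v n).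
have gs n : similarity (rg n) (g n).
  apply: similarity_comp; last exact: word_map_similarity.
  by case: (fP n).
pose s n := coding_map Phi (fun l => i n (k n + l)%N).
have Ds n : piece (v n) (s n) by apply: piece_of_prefix; case: (iP n).
have gsE n : g n (s n) = f n (coding_map Phi (i n)).
  by rewrite /g /= -(coding_map_prefix _ _ rho_lt1 PhiP).
have DK n x : piece (v n) x -> attractor Phi x.
  exact: (tree_set_attractor _ _ L_gt0 rho_lt1 PhiP).
have DM n x : piece (v n) x -> enorm x <= MK by move=> /DK /KM.
have MK0 : 0 <= MK by apply: le_trans (DM 0%N _ (Ds 0%N)); exact: enorm_ge0.
have m1 : 0 < m^-1 by rewrite invr_gt0.
pose S := ulim U (fun n => piece (v n)).
have cS : compact S by exact: ulim_compact DM.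
have SC : hausdorff_closure (tree_pieces Phi T) S.
  split.
    split=> //; apply: ulim_nonempty DM _; by apply: nearW => n; exists (s n).
  move=> e e0; have e20 : 0 < e / 2 by exact: divr_gt0.
  have [n Dn] := filter_ex (hausdorff_dist_ulim U _ _ _ DM e20).
  exists (piece (v n)); first by exists (v n).
  by apply: le_lt_trans Dn _; rewrite lte_fin; lra.
have glip n x y : enorm (g n x - g n y) <= m^-1 * enorm (x - y).
  rewrite (similarityE _ _ (gs n)) ler_wpM2r ?enorm_ge0 //.
  by case/andP: (kP n).
(* Values at [x] are bounded because [g n (s n)] lies in the cube and the [g n] have the common
   Lipschitz constant 1/m. *)
have /choice[gl glP] : forall x, exists y, ucvg U (fun n => g n x) y.
  move=> x; apply: (ultra_bounded_cvg U _ (m^-1 * (enorm x + MK) + d%:R)).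
  apply: nearW => n; have := ler_enormD (g n x - g n (s n)) (g n (s n)).
  rewrite subrK => /le_trans; apply; apply: lerD.
    apply: le_trans (glip _ _ _) _; rewrite ler_pM2l //.
    apply: le_trans (ler_enormD _ _) _; rewrite enormN lerD2l; exact: DM (Ds n).
  by rewrite gsE; apply: cube_bounded; case: (iP n).
have [q /andP[q1 _] qP] := ultra_segment_cvg U 1 m^-1 rg kP.
have glq x y : enorm (gl x - gl y) = q * enorm (x - y).
  apply/eqP; rewrite -subr_eq0 -normr_le0; apply/ler_addgt0Pr => e e0; rewrite add0r.
  set D := enorm (x - y); have D0 : 0 <= D by exact: enorm_ge0.
  have D1 : 0 < D + 1 by rewrite ltr_wpDl.
  have e3 : 0 < e / 3 by exact: divr_gt0.
  have [n [[xn yn] qn]] := filter_ex (filterI (filterI (glP x _ e3) (glP y _ e3))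
    (qP _ (divr_gt0 e3 D1))).
  have gE : enorm (g n x - g n y) = rg n * D by exact: similarityE (gs n).
  have : `|(q - rg n) * D| <= e / 3.
    rewrite normrM (ger0_norm D0) (le_trans _ (_ : `|q - rg n| * (D + 1) <= _)) //.
      by rewrite ler_wpM2l // lerDl.
    by rewrite -ler_pdivlMr // ltW.
  rewrite mulrBl !ler_norml.
  have := ler_enormB (g n x) (gl x) (gl y); have := ler_enormB (g n y) (g n x) (gl y).
  have := ler_enormB (gl x) (g n x) (g n y); have := ler_enormB (gl y) (gl x) (g n y).
  rewrite (enormBC (g n x) (gl x)) (enormBC (g n y) (gl y)) gE.
  by move=> ? ? ? ? /andP[? ?]; apply/andP; split; lra.
have gls : similarity q gl by split=> //; exact: lt_le_trans q1.
(* Equicontinuity upgrades pointwise convergence to arguments that vary with n. *)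
have gl_near t (e : R) : 0 < e -> \forall n \near U, forall t',
    m^-1 * enorm (t - t') < e / 2 -> enorm (gl t - g n t') < e.
  move=> e0; have e20 : 0 < e / 2 by exact: divr_gt0.
  apply: filterS (glP t _ e20) => n tn t' tt'.
  apply: le_lt_trans (ler_enormB (g n t) _ _) _; rewrite [ltRHS]splitr ltrD //.
  exact: le_lt_trans (glip n t t') tt'.
have clS : closed (gl @` S).
  apply: compact_closed; first exact: norm_hausdorff.
  exact: similarity_compact gls cS.
have AS : A `&` [set x | enorm (p - x) < c / 4] `<=` Q `&` gl @` S.
  move=> x [Ax px]; have xB e : 0 < e ->
      \forall n \near U, exists2 y, B n y & enorm (x - y) < e.
    move=> e0; have e20 : 0 < e / 2 by exact: divr_gt0.
    apply: filterS (near_BA _ e20) => n [_ /(_ x Ax)[y By xy]]; exists y => //.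
    by lra.
  have BQ n y : B n y -> Q y by case: (fP n) => _ _ -> [].
  split.
    apply: (iffLR (closedP_enorm _) cube_closed) => e e0.
    by have [n [y /BQ Qy xy]] := filter_ex (xB e e0); exists y.
  apply: (iffLR (closedP_enorm _) clS) => e e0.
  have e20 : 0 < Num.min (c / 4) (e / 2) by rewrite lt_min c4 divr_gt0.
  have pB : \forall n \near U, enorm (p - g n (s n)) < c / 4.
    (* Enlargements give only a non-strict bound; halving c/4 makes it strict. *)
    have c8 : 0 < c / 8 by rewrite divr_gt0.
    apply: filterS (near_BA _ c8) => n [_ /(_ p Ap)[y By py]].
    rewrite gsE; case: (iP n) => _ _; apply; exists y => //.
    by apply: le_lt_trans py _; rewrite ltr_pM2l // ltf_pV2 ?posrE // ltr_nat.
  have [t tP] : exists t : nat -> 'rV[R]_d, \forall n \near U,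
      piece (v n) (t n) /\ enorm (x - g n (t n)) < e / 2.
    apply: (ultra_choice U (fun n t => piece (v n) t /\ enorm (x - g n t) < e / 2)).
    apply: filterS2 (xB _ e20) pB => n [y By].
    rewrite lt_min => /andP[xy4 xy2] pn.
    have [r1 fs BE] := fP n; move: By; rewrite BE => -[_ [z Fz zy]].
    have [[s' Ds' zs']|zs] := piece_separation _ _ L_gt0 rho_lt1 PhiP T c c_gt0 c_sep
        (v n) (s n) z (DK _ _ (Ds n)) Fz.
      by exists s'; split=> //; rewrite /g /= -zs' zy.
    (* Here the lower bound 1 on the total magnification is used: separation by [c] survives in the
       n-th miniset. *)
    exfalso; have : c <= enorm (y - g n (s n)).
      rewrite -zy /g /= (similarityE _ _ fs).
      apply: le_trans (_ : c <= r n * (c * word_ratio rho (v n))) _.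
        rewrite mulrCA ler_peMr ?(ltW c_gt0) //; by case/andP: (kP n).
      by rewrite ler_pM2l // (lt_le_trans _ r1).
    have := ler_enormB x y (g n (s n)); have := ler_enormB p x (g n (s n)).
    by rewrite (enormBC y x) (enormBC x p); move: px => /=; lra.
  have [|l tl] := ultra_bounded_cvg U t MK.
    by apply: filterS tP => n [/DM].
  have Sl : S l by apply: ulim_ucvg tl; apply: filterS tP => n [].
  exists (gl l); first by exists l.
  have em : 0 < m * (e / 4) by rewrite mulr_gt0 // divr_gt0.
  have e20' : 0 < e / 2 by exact: divr_gt0.
  have [n [[[_ xt] tn] ln]] :=
    filter_ex (filterI (filterI tP (tl _ em)) (gl_near l _ e20')).
  apply: le_lt_trans (ler_enormB (g n (t n)) _ _) _; rewrite [ltRHS]splitr ltrD //.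
  rewrite enormBC; apply: ln; rewrite mulrC -ltr_pdivlMr // invrK mulrC.
  by have -> : e / 2 / 2 = e / 4 by field.
have SA : (Q `&` gl @` S) `&` interior Q `<=` A.
  move=> _ [[_ [t St <-]] /interiorP_enorm[e1 e10 Qe1]].
  apply: (iffLR (closedP_enorm _) clA) => e e0.
  have e20 : 0 < Num.min e1 (e / 2) by rewrite lt_min e10 divr_gt0.
  have em : 0 < m * (Num.min e1 (e / 2) / 2) by rewrite mulr_gt0 // divr_gt0.
  have e2 : 0 < e / 2 by exact: divr_gt0.
  have [n [[[t' Dt' tt'] gt'] [BnA _]]] :=
    filter_ex (filterI (filterI (St _ em) (gl_near t _ e20)) (near_BA _ e2)).
  have : enorm (gl t - g n t') < Num.min e1 (e / 2).
    by apply: gt'; rewrite mulrC ltr_pdivrMr // mulrC.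
  rewrite lt_min => /andP[tn1 tn2].
  (* The open cube is needed here: the approximating point must still lie in the cube to belong to
     the n-th miniset. *)
  have Bn : B n (g n t').
    case: (fP n) => _ _ ->; split; first exact: Qe1.
    exists (word_map Phi (v n) t') => //.
    by apply: (word_map_piece _ _ rho_lt1 PhiP _ T_tree _ (Tv n)); exists t'.
  have [y Ay ny] := BnA _ Bn; exists y => //.
  by apply: le_lt_trans (ler_enormB (g n t') _ _) _; lra.
exists (Q `&` gl @` S); split.
  exists S => //; split; last by exists gl => //; exists q.
  by exists p; apply: AS; split=> //=; rewrite subrr enorm0.
apply/eqP; rewrite eq_le; apply/andP; split; last first.
  by apply: le_trans Adim _; exact: hausdorff_dim_sub.
apply: le_trans (hausdorff_dim_cube_interior _ d_gt0 (@subIsetl _ _ _)) _.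
by rewrite ge_max (ltW dA) andbT; exact: hausdorff_dim_sub.
Qed.

End TreeMicrosets.

Theorem corollary3p13 (R : realType) (d : nat) (d_gt0 : (0 < d)%N)
    (F : set 'rV[R]_d) (F_nonempty : F !=set0) (F_compact : compact F)
    (L : finType) (Phi : L -> 'rV[R]_d -> 'rV[R]_d)
    (Phi_IFS : similarity_IFS Phi) (Phi_SSC : SSC Phi)
    (T : set (seq L)) (T_leafless : leafless_tree T)
    (F_tree : F = tree_set Phi T) :
  [set hausdorff_dim S | S in hausdorff_closure (tree_pieces Phi T)]
    `<=` [set hausdorff_dim A | A in interior_microsets F]
  /\
  [set hausdorff_dim A | A in interior_microsets F]
    `&` [set` `](d%:R - 1)%:E, d%:R%:E]]
  = [set hausdorff_dim B | B in
      [set B | exists2 S, hausdorff_closure (tree_pieces Phi T) S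
                        & miniset S B]]
    `&` [set` `](d%:R - 1)%:E, d%:R%:E]].
Proof.
have [L_gt0 Phi_contr] := Phi_IFS; have [T_tree _] := T_leafless.
have /choice[rho rhoP] : forall a, exists r : R, r < 1 /\ similarity r (Phi a).
  by move=> a; have [r ? ?] := Phi_contr a; exists r.
have rho_lt1 a : rho a < 1 by case: (rhoP a).
have PhiP a : similarity (rho a) (Phi a) by case: (rhoP a).
have [c c_gt0 c_sep] := SSC_separation _ _ L_gt0 rho_lt1 PhiP Phi_SSC.
rewrite F_tree; split.
  move=> _ [S SC <-].
  have [A FA AS] := dim_closure_interior_microset _ _ L_gt0 rho_lt1 PhiP _ T_tree
    _ c_gt0 c_sep S SC.
  by exists A.
apply/seteqP; split=> x [[A] + <-].
  move=> FA; rewrite /= in_itv /= => dA; split=> //.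
  have [|B [SB BA]] := dim_microset_miniset _ _ d_gt0 L_gt0 rho_lt1 PhiP _ T_tree
    _ c_gt0 c_sep A FA; first by case/andP: dA.
  by exists B.
move=> [S SC SA]; rewrite /= in_itv /= => dA; split=> //.
have [|B FB BA] := dim_closure_miniset _ _ d_gt0 L_gt0 rho_lt1 PhiP _ T_tree
  _ c_gt0 c_sep S A SC SA; first by case/andP: dA.
by exists B.
Qed.
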